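(* Let $G$ be a metrizable compact group and let $X=(X_t)_{t\ge 0}$ be a Lévy process in $G$. For every $t\ge 0$ let $\mu_t$ be the distribution of $X_0^{-1}X_t$ and let $S_t$ be the support of $\mu_t$. Then the following statements are equivalent: (i) The set $\bigcup_{t\ge 0} S_t$ is dense in $G$. (ii) The paths $t\mapsto X_t$ of $X$ are, with probability one, continuously uniformly distributed in $G$.
   Context: $G$ is a metrizable compact group, written multiplicatively, with Borel $\sigma$-algebra $\mathcal{B}_G$; $\lambda_G$ denotes the normalized Haar (probability) measure on $(G,\mathcal{B}_G)$, and $C(G)$ the space of continuous complex-valued functions on $G$. A measurable function $\gamma:[0,+\infty)\to G$ is continuously uniformly distributed (c.u.d.) in $G$ if $$\lim_{T\to+\infty}\frac1T\int_0^T\varphi(\gamma(t))\,\mathrm{d}t=\int_G\varphi\,\mathrm{d}\lambda_G\quad\text{for all }\varphi\in C(G).$$ A Lévy process in $G$ is a family $X=(X_t)_{t\ge0}$ of $G$-valued random variables on a probability space $(\Omega,\mathcal{F},\mathbb{P})$ such that: (1) for any $0\le t_1<t_2$ the distribution of $X_{t_1}^{-1}X_{t_2}$ is the same as that of $X_0^{-1}X_{t_2-t_1}$; (2) the random variables $X_{t_1},X_{t_1}^{-1}X_{t_2},X_{t_2}^{-1}X_{t_3},\dots,X_{t_{n-1}}^{-1}X_{t_n}$ are independent whenever $n\ge2$ and $0\le t_1<t_2<\dots<t_n$; (3) for $\mathbb{P}$-almost all $\omega\in\Omega$ the function $t\mapsto X_t(\omega)$ is right-continuous on $[0,\infty)$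 and has left limits in $G$ at every $t>0$. The distribution of $X_0$ is arbitrary. The support of a probability measure $\nu$ on $(G,\mathcal{B}_G)$ is the smallest closed set $F\subseteq G$ with $\nu(F)=1$. *)

(* Defs.v *)
From HB Require Import structures.
From mathcomp Require Import all_boot all_order all_algebra.
From mathcomp Require Import complex.
From mathcomp Require Import all_classical all_reals all_analysis.

Set Implicit Arguments.
Unset Strict Implicit.
Unset Printing Implicit Defensive.

Import Order.TTheory GRing.Theory Num.Theory.
Import numFieldNormedType.Exports.

Local Open Scope classical_set_scope.
Local Open Scope ring_scope.

HB.mixin Record isTopologicalGroup G & Topological G & Group G := {
  mulg_continuous : continuous (fun x : G * G => (x.1 * x.2)%g) ;
  invg_continuous : continuous (fun x : G => (x^-1)%g) ;
}.

(* The library only equips generated sigma-algebras on pointed types; a group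
   is nonempty, so asking for a base point is no restriction. *)
#[short(type="topologicalGroupType")]
HB.structure Definition TopologicalGroup :=
  {G of PointedTopological G & Group G & isTopologicalGroup G}.

Definition metrizable (R : realType) (T : topologicalType) : Prop :=
  exists dist : T -> T -> R,
    [/\ forall x y, dist x y = 0 <-> x = y,
        forall x y, dist x y = dist y x,
        forall x y z, dist x z <= dist x y + dist y z &
        forall x (A : set T), nbhs x A <->
          exists2 e : R, 0 < e & [set y | dist x y < e] `<=` A].

(* The carrier of [G] with its Borel sigma-algebra. *)
Notation borel G := (g_sigma_algebraType (@open G)).

Definition is_haar (R : realType) (G : topologicalGroupType)
    (lambda : probability (borel G) R) : Prop :=
  forall (g : G) (A : set G), measurable (A : set (borel G)) ->
    lambda [set (g * x)%g | x in A] = lambda A.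

(* [smallest C B] is the intersection of all members of [C] that contain [B]. *)
Definition measure_support (R : realType) (G : topologicalGroupType)
    (nu : set (borel G) -> \bar R) : set G :=
  smallest [set F : set G | closed F /\ nu F = 1%E] set0.

Definition Cintegral d (T : measurableType d) (R : realType)
    (mu : {measure set T -> \bar R}) (D : set T) (f : T -> R[i]) : R[i] :=
  ((\int[mu]_(x in D) complex.Re (f x)) +i* (\int[mu]_(x in D) complex.Im (f x)))%C.

(* [R[i]^o] is [R[i]] with the topology of the complex modulus. Only the
   restriction of [gamma] to [0, +oo[ matters. *)
Definition cud (R : realType) (G : topologicalGroupType)
    (lambda : probability (borel G) R) (gamma : R -> G) : Prop :=
  measurable_fun (`[0, +oo[ : set R) (gamma : R -> borel G) /\
  forall phi : G -> R[i]^o, continuous phi ->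
    ((T^-1)%:C%C * Cintegral lebesgue_measure `[0, T] (phi \o gamma) : R[i]^o)
      @[T --> +oo] --> (Cintegral lambda setT phi : R[i]^o).

(* Mutual independence: the product rule over every subfamily. *)
Definition independent d (Omega : measurableType d) (R : realType)
    (P : probability Omega R) d' (E : measurableType d') (I : finType)
    (Y : I -> Omega -> E) : Prop :=
  forall (J : {set I}) (A : I -> set E), (forall i, measurable (A i)) ->
    P (\bigcap_(i in [set` J]) Y i @^-1` A i) =
    (\prod_(i in J) P (Y i @^-1` A i))%E.

Definition increment (R : realType) d (Omega : measurableType d)
    (P : probability Omega R) (G : topologicalGroupType)
    (X : R -> {RV P >-> borel G}) (s t : R) : Omega -> borel G :=
  fun w => ((X s w : G)^-1 * (X t w : G))%g.

(* Time ranges over [0, +oo[; the variables at negative times are junk and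
   are not constrained. *)
Record is_levy (R : realType) d (Omega : measurableType d)
    (P : probability Omega R) (G : topologicalGroupType)
    (X : R -> {RV P >-> borel G}) : Prop := IsLevy {
  levy_stationary : forall t1 t2, 0 <= t1 -> t1 < t2 ->
    forall A : set (borel G), measurable A ->
      pushforward P (increment X t1 t2) A =
      pushforward P (increment X 0 (t2 - t1)) A ;
  (* There are n = m + 2 times t 0 < ... < t m.+1; member 0 of the family is
     X_(t 0) and member k + 1 is the increment from t k to t k.+1. *)
  levy_independent : forall (m : nat) (t : nat -> R), 0 <= t 0%N ->
    (forall k, (k <= m)%N -> t k < t k.+1) ->
    independent P (fun k : 'I_m.+2 => match val k with
      | 0%N => X (t 0%N) : Omega -> borel G
      | k'.+1 => increment X (t k') (t k'.+1)
      end) ;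
  levy_cadlag : {ae P, forall w,
    (forall t : R, 0 <= t -> (X s w : G) @[s --> t^'+] --> (X t w : G)) /\
    (forall t : R, 0 < t -> exists l : G, (X s w : G) @[s --> t^'-] --> l)}
}.

(* Main.v *)
(** Write [P_t f (x)] for the integral of [f (x y)] against [mu_t (dy)]. By the
    independence of the increments, the variables [f (X_(t+h)) - P_h f (X_t)]
    are orthogonal at times at distance at least [h]; hence their time averages
    have variance [O(1/T)] and vanish almost surely along [T = n^2], so for all
    [T]. Thus [f] and [P_h f] have asymptotically the same averages along almost
    every path. If the supports are dense, compactness provides a finite mean [Q]
    of operators [P_t] contracting the oscillation of every function with a
    prescribed left modulus of continuity (a Doeblin estimate). Since [Q]
    preserves that modulus, its iterates on [f] come close to a constant, which
    is close to the Haar integral because [Q] preserves Haar integrals.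
    Partitions of unity reduce the test functions to countably many.
    Conversely, if a nonempty open set [U] misses all the supports, then on
    almost every path [X_0^-1 X_t] avoids a smaller open set at all rational
    times, hence a bump function supported in [U], translated by [X_0], vanishes
    along the path although its Haar integral is positive. *)
From HB Require Import structures.
Require Import Defs.
From mathcomp Require Import all_boot all_order all_algebra.
From mathcomp Require Import complex lra ring.
From mathcomp Require Import all_classical all_reals all_analysis measurable_realfun.

Set Implicit Arguments.
Unset Strict Implicit.
Unset Printing Implicit Defensive.

Import Order.TTheory GRing.Theory Num.Theory.
Import numFieldNormedType.Exports.
Local Open Scope classical_set_scope.
Local Open Scope ring_scope.

(** The law of [X_0] is arbitrary, so no stationarity is available along the paths; the variance
    estimate rests on identities involving two times only, which the Markov property provides. The
    operators [P_t] average over right translates and hence commute with left translations. A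
    neighbourhood [W] of the identity such that [f (g x)] is within a tolerance of [f x] for all [g]
    in [W] therefore serves all iterates at once, and the contraction factor, which depends on [W]
    alone, never deteriorates. The price is that the contraction only works while the oscillation is
    large compared with the tolerance: every [f] is brought within a chosen [e] of a constant, and
    the exceptional null set depends on [f] and [e] until countable families are intersected. A
    single [mu_t] may miss many open sets; this is why several times are averaged. Integrating over
    time and chance together requires joint measurability, so functions of the path are set to zero
    on a null set carrying all irregular paths. *)

Section bounded_integrals.
Context {d : measure_display} {T : measurableType d} {R : realType}.
Variable mu : {measure set T -> \bar R}.

Lemma le_integrable_cst (A : set T) (f : T -> R) (C : R) :
  measurable A -> (mu A < +oo)%E -> measurable_fun A f ->
  (forall x, A x -> `|f x| <= C) -> mu.-integrable A (EFin \o f).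
Proof.
move=> mA Aoo mf fC; apply: measurable_bounded_integrable => //.
exists C; split; first exact: num_real.
by move=> M CM x Ax; rewrite /= (le_trans (fC x Ax))// ltW.
Qed.

Lemma le_normr_Rintegral_cst (A : set T) (f : T -> R) (C : R) :
  measurable A -> (mu A < +oo)%E -> measurable_fun A f ->
  (forall x, A x -> `|f x| <= C) ->
  `|\int[mu]_(x in A) f x| <= C * fine (mu A).
Proof.
move=> mA Aoo mf fC; have fi := le_integrable_cst mA Aoo mf fC.
rewrite (le_trans (le_normr_Rintegral mA fi))// -Rintegral_cst//.
apply: le_Rintegral => //.
- apply: (@le_integrable_cst _ _ C) => //; first exact: measurableT_comp.
  by move=> x Ax; rewrite normr_id fC.
- by apply: (@le_integrable_cst _ _ `|C|) => //; exact: measurable_cst.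
Qed.

End bounded_integrals.

(** * Fubini's theorem for bounded functions on rectangles of finite measure *)

Section bounded_Fubini.
Context {d1 d2 : measure_display} {T1 : measurableType d1}
  {T2 : measurableType d2} {R : realType}.
Variables (m1 : {sigma_finite_measure set T1 -> \bar R})
  (m2 : {sigma_finite_measure set T2 -> \bar R}).
Variables (A : set T1) (B : set T2) (f : T1 * T2 -> R) (C : R).
Hypotheses (mA : measurable A) (mB : measurable B).
Hypotheses (Aoo : (m1 A < +oo)%E) (Boo : (m2 B < +oo)%E).
Hypotheses (mf : measurable_fun setT f) (fC : forall z, `|f z| <= C).

(** Extension by zero turns integrals over [A] and [B] into integrals over the whole spaces, to
    which Fubini's theorem for integrable functions applies. *)
Let g : T1 * T2 -> R := f \_ (A `*` B).

Let gE1 x : \int[m2]_y g (x, y) = ((fun x => \int[m2]_(y in B) f (x, y)) \_ A) x.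
Proof.
rewrite patchE; case: ifPn => xA.
  rewrite [RHS]Rintegral_mkcond; apply: eq_Rintegral => y _.
  rewrite /g !patchE; congr (if _ then _ else _).
  by apply/idP/idP; rewrite !inE /=; [case|move=> yB; split=> //; exact: set_mem].
rewrite (_ : (fun y => _) = cst 0) ?Rintegral_cst ?mul0r//.
apply/funext => y; rewrite /g patchE ifN//; apply: contra xA.
by rewrite !inE => -[].
Qed.

Let gE2 y : \int[m1]_x g (x, y) = ((fun y => \int[m1]_(x in A) f (x, y)) \_ B) y.
Proof.
rewrite patchE; case: ifPn => yB.
  rewrite [RHS]Rintegral_mkcond; apply: eq_Rintegral => x _.
  rewrite /g !patchE; congr (if _ then _ else _).
  by apply/idP/idP; rewrite !inE /=; [case|move=> xA; split=> //; exact: set_mem].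
rewrite (_ : (fun x => _) = cst 0) ?Rintegral_cst ?mul0r//.
apply/funext => x; rewrite /g patchE ifN//; apply: contra yB.
by rewrite !inE => -[].
Qed.

Let mAB : measurable (A `*` B). Proof. exact: measurableX. Qed.

Let ABoo : ((m1 \x m2)%E (A `*` B) < +oo)%E.
Proof. by rewrite product_measure1E//; apply: lte_mul_pinfty => //; rewrite ge0_fin_numE. Qed.

Let fi : (m1 \x m2)%E.-integrable (A `*` B) (EFin \o f).
Proof. apply: (le_integrable_cst (C := C)) => //; exact: measurable_funTS mf. Qed.

Let gi : (m1 \x m2)%E.-integrable setT (EFin \o g).
Proof. rewrite -restrict_EFin; exact/(integrable_mkcond _ mAB). Qed.

Let gC z : `|g z| <= `|C|.
Proof.
by rewrite /g patchE; case: ifP => _; rewrite ?normr0// (le_trans (fC z))// ler_norm.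
Qed.

Let mg : measurable_fun setT g.
Proof. by apply/measurable_EFinP; exact: measurable_int gi. Qed.

Let g1i x : m2.-integrable setT (fun y => (g (x, y))%:E).
Proof.
have -> : (fun y => (g (x, y))%:E) = (EFin \o (fun y => g (x, y))) \_ B.
  apply/funext => y; rewrite [RHS]patchE; case: ifPn => //= yB.
  by rewrite /g patchE ifN//; apply: contra yB; rewrite !inE => -[].
apply/(integrable_mkcond _ mB).1.
apply: (le_integrable_cst (C := `|C|)) => //.
by apply: measurable_funTS; exact: (measurableT_comp mg).
Qed.

Let g2i y : m1.-integrable setT (fun x => (g (x, y))%:E).
Proof.
have -> : (fun x => (g (x, y))%:E) = (EFin \o (fun x => g (x, y))) \_ A.
  apply/funext => x; rewrite [RHS]patchE; case: ifPn => //= xA.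
  by rewrite /g patchE ifN//; apply: contra xA; rewrite !inE => -[].
apply/(integrable_mkcond _ mA).1.
apply: (le_integrable_cst (C := `|C|)) => //.
by apply: measurable_funTS; exact: (measurableT_comp mg).
Qed.

Lemma measurable_fun_Rintegral1 :
  measurable_fun A (fun x => \int[m2]_(y in B) f (x, y)).
Proof.
apply/(measurable_restrictT _ mA).
rewrite [X in measurable_fun _ X](_ : _ = fun x => \int[m2]_y g (x, y)); last first.
  by apply/funext => x; rewrite gE1.
apply/measurable_EFinP.
rewrite (_ : _ \o _ = fubini_F m2 (EFin \o g)); last first.
  apply/funext => x; rewrite /fubini_F /= /Rintegral fineK//.
  exact: integrable_fin_num.
exact: measurable_fubini_F gi.
Qed.

Lemma measurable_fun_Rintegral2 :
  measurable_fun B (fun y => \int[m1]_(x in A) f (x, y)).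
Proof.
apply/(measurable_restrictT _ mB).
rewrite [X in measurable_fun _ X](_ : _ = fun y => \int[m1]_x g (x, y)); last first.
  by apply/funext => x; rewrite gE2.
apply/measurable_EFinP.
rewrite (_ : _ \o _ = fubini_G m1 (EFin \o g)); last first.
  apply/funext => x; rewrite /fubini_G /= /Rintegral fineK//.
  exact: integrable_fin_num.
exact: measurable_fubini_G gi.
Qed.

Lemma Rintegral_product_measure :
  \int[m1]_(x in A) \int[m2]_(y in B) f (x, y) =
  \int[(m1 \x m2)%E]_(z in A `*` B) f z.
Proof.
rewrite [LHS]Rintegral_mkcond [RHS]Rintegral_mkcond.
transitivity (\int[m1]_x \int[m2]_y g (x, y)).
  by apply: eq_Rintegral => x _; rewrite gE1.
rewrite /Rintegral -(integral12_prod_meas1 gi); congr fine.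
by apply: eq_integral => x _; rewrite fineK//; exact: integrable_fin_num.
Qed.

Lemma Rintegral_Fubini :
  \int[m1]_(x in A) \int[m2]_(y in B) f (x, y) =
  \int[m2]_(y in B) \int[m1]_(x in A) f (x, y).
Proof.
rewrite [LHS]Rintegral_mkcond [RHS]Rintegral_mkcond.
transitivity (\int[m1]_x \int[m2]_y g (x, y)).
  by apply: eq_Rintegral => x _; rewrite gE1.
transitivity (\int[m2]_y \int[m1]_x g (x, y)); last first.
  by apply: eq_Rintegral => x _; rewrite gE2.
rewrite /Rintegral; congr fine.
rewrite -[RHS](_ : \int[m2]_y \int[m1]_x (EFin \o g) (x, y) = _)%E.
  rewrite -(Fubini gi).
  by apply: eq_integral => x _; rewrite fineK//; exact: integrable_fin_num.
by apply: eq_integral => x _; rewrite fineK//; exact: integrable_fin_num.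
Qed.

End bounded_Fubini.

(** * Countable families of balls in a compact metrizable space *)

Section metrizable_compact.
Context {R : realType} {G : ptopologicalType}.
Hypotheses (G_compact : compact [set: G]) (G_metrizable : metrizable R G).

(** [psi k i] is a tent function: the sets [0 < psi k i] are balls whose radius
    depends only on [k] and tends to [0]. *)
Lemma metrizable_compact_base : exists (N : nat -> nat) (psi : nat -> nat -> G -> R),
  [/\ forall k i, continuous (psi k i),
      forall k x, exists2 i, (i < N k)%N & 0 < psi k i x,
      forall x (A : set G), nbhs x A -> exists k, forall i, 0 < psi k i x ->
        [set y | 0 < psi k i y] `<=` A &
      forall f : G -> R, continuous f -> forall e, 0 < e -> exists k, forall i x y,
        0 < psi k i x -> 0 < psi k i y -> `|f x - f y| <= e].
Proof.
have [dist [d0 dC dtri dnbhs]] := G_metrizable.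
have dball x e : 0 < e -> nbhs x [set y | dist x y < e].
  by move=> e0; apply/dnbhs; exists e.
have dxx x : dist x x = 0 by apply/d0.
have dcont q : continuous (dist q).
  move=> x; apply/cvgrPdist_lt => e e0.
  have := dball x e e0; apply: filterS => y /= xy.
  have := dtri q x y; have := dtri q y x; rewrite (dC y x) => h1 h2.
  by rewrite ltr_norml; apply/andP; split; lra.
have dopen q e : open [set y | dist q y < e].
  rewrite openE => y /= qy; apply/dnbhs; exists (e - dist q y); first by rewrite subr_gt0.
  by move=> z /= yz; have := dtri q y z; lra.
(* Two points of a ball of radius [u k] are less than [2 * u k] apart, hence the factor [2]. *)
have [u [u0 small]] : exists u : nat -> R, (forall k, 0 < u k) /\
    forall r, 0 < r -> exists k, 2 * u k < r.
  exists (fun k => k.+1%:R^-1); split=> [k|r r0]; first by rewrite invr_gt0.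
  have [k /= rk] := @ltr_add_invr R 0 (r / 2) (divr_gt0 r0 (ltr0Sn _ 1)).
  by exists k; move: rk; rewrite add0r => ?; rewrite mulrC -ltr_pdivlMr.
have finite_net k : exists D : seq G,
    forall x, exists2 q, q \in D & dist q x < u k.
  have := G_compact; rewrite compact_cover => /(_ G setT
    (fun q => [set y | dist q y < u k])) [|x _|D _ cD].
  - by move=> i _; exact: dopen.
  - by exists x => //=; rewrite dxx.
  - by exists (finmap.enum_fset D) => x; have [q qD qx] := cD x I; exists q.
have [D hD] := choice finite_net.
exists (fun k => size (D k)), (fun k i x => u k - dist (nth point (D k) i) x).
split.
- move=> k i x; apply: cvgB; first exact: cvg_cst.
  exact: dcont.
- move=> k x; have [q qD qx] := hD k x; exists (index q (D k)).
    by rewrite index_mem.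
  by rewrite nth_index// subr_gt0.
- move=> x A /dnbhs[e e0 eA]; have [k ke] := small e e0; exists k => i.
  rewrite subr_gt0 => ix y /=; rewrite subr_gt0 => iy; apply: eA => /=.
  by have := dtri x (nth point (D k) i) y; rewrite (dC x (nth _ _ _)); lra.
- move=> f cf e e0.
  (* Uniform continuity through near coverings: with [r / 2] for the move from [x] to [y] and
     [r / 2] for the distance from [y] to [z], both points stay within [r] of [x]. *)
  have [r r0 fr] : exists2 r, 0 < r & forall x y, dist x y < r -> `|f x - f y| <= e.
    have := (compact_near_coveringP [set: G]).1 G_compact R (0^'+)
      (fun r x => forall y, dist x y < r -> `|f x - f y| <= e) _.
    case.
      move=> x _; have /cvgrPdist_lt/(_ _ (divr_gt0 e0 (ltr0Sn _ 1))) := cf x.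
      move=> /dnbhs[r r0 fr].
      exists ([set y | dist x y < r / 2], [set s | s < r / 2]) => /=.
        split; first by apply: dball; rewrite divr_gt0.
        by apply: nbhs_right_lt; rewrite divr_gt0.
      move=> [y s] /= [xy sr] z yz.
      have fy : `|f x - f y| < e / 2 by apply: fr => /=; lra.
      have fz : `|f x - f z| < e / 2.
        by apply: fr => /=; have := dtri x y z; lra.
      by rewrite (le_trans (ler_distD (f x) _ _))// distrC; lra.
    move=> r /= r0 hr; exists (r / 2); first by rewrite divr_gt0.
    move=> x y; apply: (hr (r / 2)) => //=; last by rewrite divr_gt0.
    by rewrite sub0r normrN ger0_norm; lra.
  have [k kr] := small r r0; exists k => i x y; rewrite !subr_gt0 => ix iy.
  by apply: fr; have := dtri x (nth point (D k) i) y; rewrite (dC x (nth _ _ _)); lra.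
Qed.

End metrizable_compact.

(** * Borel structure and uniform continuity on a compact metrizable group *)

Section compact_metrizable_group.
Context {R : realType} {G : topologicalGroupType}.
Hypotheses (G_compact : compact [set: G]) (G_metrizable : metrizable R G).

Lemma open_borel (U : set G) : open U -> measurable (U : set (borel G)).
Proof. exact: sub_sigma_algebra. Qed.

Lemma continuous_measurable_borel (f : G -> R) :
  continuous f -> measurable_fun setT (f : borel G -> R).
Proof.
move=> /continuousP cf; apply: (measurability _ (RGenOpens.measurableE R)).
move=> _ [_ [a [b ->] <-]]; rewrite setTI; apply: open_borel.
exact/cf/interval_open.
Qed.

(** Second countability puts the open sets of the product into the product sigma-algebra: they are
    countable unions of rectangles with sides [V k i]. *)
Lemma open_measurable_prod (U : set (G * G)) :
  open U -> measurable (U : set (borel G * borel G)).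
Proof.
have [N [psi [cpsi cover base _]]] :=
  metrizable_compact_base G_compact G_metrizable.
move=> oU; pose V k i := [set y : G | 0 < psi k i y].
have mV k i : measurable (V k i : set (borel G)).
  have -> : V k i = setT `&` psi k i @^-1` `]0, +oo[.
    by rewrite setTI; apply/seteqP; split => x /=; rewrite in_itv /= andbT.
  by apply: continuous_measurable_borel => //; exact: cpsi.
pose W (n : nat * nat * (nat * nat)) := V n.1.1 n.1.2 `*` V n.2.1 n.2.2.
have -> : U = \bigcup_(n in [set n | W n `<=` U]) W n.
  apply/seteqP; split=> [[x y] Uxy|z [n /= WU]]; last exact: WU.
  have := oU; rewrite openE => /(_ _ Uxy)[[A B] /= [nA nB] AB].
  have [k hk] := base _ _ nA; have [l hl] := base _ _ nB.
  have [i _ ix] := cover k x; have [j _ jy] := cover l y.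
  exists ((k, i), (l, j)) => //= -[a b] [/= ka lb]; apply: AB; split.
    exact: hk ka.
  exact: hl lb.
rewrite bigcup_mkcond; apply: countable_bigcupT_measurable; first exact: countableP.
by move=> n; case: ifP => // _; exact: measurableX.
Qed.

Lemma continuous_measurable_prod (f : G * G -> R) :
  continuous f -> measurable_fun setT (f : borel G * borel G -> R).
Proof.
move=> /continuousP cf; apply: (measurability _ (RGenOpens.measurableE R)).
move=> _ [_ [a [b ->] <-]]; rewrite setTI; apply: open_measurable_prod.
exact/cf/interval_open.
Qed.

Lemma continuous_measurable_prod_borel (f : G * G -> G) :
  continuous f -> measurable_fun setT (f : borel G * borel G -> borel G).
Proof.
move=> /continuousP cf; apply: (measurability (@open G : set (set (borel G))) erefl).
by move=> _ [A oA <-]; rewrite setTI; apply: open_measurable_prod; exact: cf oA.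
Qed.

Lemma continuous_measurable_self (f : G -> G) :
  continuous f -> measurable_fun setT (f : borel G -> borel G).
Proof.
move=> /continuousP cf; apply: (measurability (@open G : set (set (borel G))) erefl).
by move=> _ [A oA <-]; rewrite setTI; apply: open_borel; exact: cf oA.
Qed.

Lemma cvg_mulg {T : Type} (F : set_system T) {FF : Filter F} (f g : T -> G) (a b : G) :
  f @ F --> a -> g @ F --> b -> (f x * g x)%g @[x --> F] --> (a * b)%g.
Proof.
move=> fa gb.
apply: (@cvg_comp _ _ _ (fun x => (f x, g x)) (fun z => (z.1 * z.2)%g) F
  (nbhs (a, b))); first exact: cvg_pair.
exact: (@mulg_continuous G (a, b)).
Qed.

Lemma continuous_mulgl (a : G) : continuous (fun x : G => (a * x)%g).
Proof.
by move=> x; apply: cvg_mulg; [exact: cvg_cst|exact: cvg_id].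
Qed.

Lemma continuous_mulgr (a : G) : continuous (fun x : G => (x * a)%g).
Proof.
by move=> x; apply: cvg_mulg; [exact: cvg_id|exact: cvg_cst].
Qed.

Lemma continuous_divgl : continuous (fun z : G * G => (z.1^-1 * z.2)%g).
Proof.
move=> z; apply: cvg_mulg; last exact: cvg_snd.
by apply: continuous_cvg; [exact: invg_continuous|exact: cvg_fst].
Qed.

Lemma measurable_divgl d (T : measurableType d) (f g : T -> borel G) :
  measurable_fun setT f -> measurable_fun setT g ->
  measurable_fun setT (fun x => ((f x : G)^-1 * (g x : G))%g : borel G).
Proof.
move=> mf mg; have mD := continuous_measurable_prod_borel continuous_divgl.
exact: (measurableT_comp mD (measurable_fun_pair mf mg)).
Qed.

(** The translation is on the left because averaging over right translates keeps the bound with the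
    same [g] and [e]. *)
Definition left_unif (f : G -> R) :=
  forall e, 0 < e -> \forall g \near (1%g : G), forall x, `|f (g * x)%g - f x| <= e.

(** The difference [f (g * x) - f x] is jointly continuous and vanishes at [g = 1]; compactness in
    [x] makes the neighbourhood of [1] uniform. *)
Lemma continuous_left_unif (f : G -> R) : continuous f -> left_unif f.
Proof.
move=> cf e e0.
suff : \forall g \near (1%g : G),
    [set: G] `<=` (fun x => `|f (g * x)%g - f x| <= e).
  by apply: filterS => g Ug x; exact: Ug.
apply: (compact_near_coveringP [set: G]).1 => // x _.
suff /cvgrPdist_le/(_ e e0) : (fun z : G * G => f (z.2 * z.1)%g - f z.1) z @[z --> (x, 1%g : G)] --> (0 : R).
  by apply: filterS => -[y g] /=; rewrite sub0r normrN.
rewrite -[0](subrr (f x)); apply: cvgB.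
  have zx : (z.2 * z.1)%g @[z --> (x, 1%g : G)] --> x.
    by rewrite -[X in _ --> X]mul1g; exact: cvg_mulg cvg_snd cvg_fst.
  exact: cvg_comp zx (cf x).
by apply: continuous_cvg; [exact: cf|exact: cvg_fst].
Qed.

(** A point [y] near [x] is the left translate of [x] by [y * x^-1], which is near [1]. *)
Lemma left_unif_continuous (f : G -> R) : left_unif f -> continuous f.
Proof.
move=> uf x; apply/cvgrPdist_le => e e0; have := uf e e0.
have : (y * x^-1)%g @[y --> x] --> (1%g : G).
  by have := @continuous_mulgr (x^-1)%g x; rewrite /continuous_at mulgV.
move=> yx near1; near=> y.
have : forall z, `|f ((y * x^-1) * z)%g - f z| <= e by near: y; exact: yx near1.
by move/(_ x); rewrite mulgVK distrC.
Unshelve. all: by end_near.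
Qed.

End compact_metrizable_group.

Section probability_constants.
Context {R : realType} {d : measure_display} {T : measurableType d}.
Variable P : probability T R.

Lemma probability_lty : (P setT < +oo)%E.
Proof. exact: (le_lt_trans (probability_le1 P measurableT) (ltry 1)). Qed.

Lemma fine_probability_setT : fine (P setT) = 1.
Proof. by rewrite probability_setT. Qed.

Lemma Rintegral_probability_cst (c : R) : \int[P]_(x in setT) c = c.
Proof. by rewrite Rintegral_cst// fine_probability_setT mulr1. Qed.

End probability_constants.

(** * Convolution operators and their finite means *)

Section convolution.
Context {R : realType} {G : topologicalGroupType}.
Hypotheses (G_compact : compact [set: G]) (G_metrizable : metrizable R G).
Implicit Types (f : G -> R) (nu : probability (borel G) R).

Lemma compact_continuous_bounded f :
  continuous f -> exists C, forall x, `|f x| <= C.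
Proof.
move=> cf; have : compact (f @` [set: G]).
  by apply: continuous_compact => //; exact: continuous_subspaceT.
move=> /compact_bounded[C [_ fC]]; exists (C + 1) => x.
by apply: (fC (C + 1)); [rewrite ltrDl|exists x].
Qed.

Lemma continuous_integrable nu f :
  continuous f -> nu.-integrable setT (EFin \o (f : borel G -> R)).
Proof.
move=> cf; have [C fC] := compact_continuous_bounded cf.
apply: (le_integrable_cst (C := C)) => //.
  exact: probability_lty.
exact: continuous_measurable_borel cf.
Qed.

Lemma continuous_shiftl (a : G) f : continuous f -> continuous (fun y => f (a * y)%g).
Proof.
move=> cf y; exact: (@cvg_comp _ _ _ (fun y => (a * y)%g) f _ _ _
  (@continuous_mulgl G a y) (cf _)).
Qed.

Lemma continuous_shiftr (a : G) f : continuous f -> continuous (fun y => f (y * a)%g).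
Proof.
move=> cf y; exact: (@cvg_comp _ _ _ (fun y => (y * a)%g) f _ _ _
  (@continuous_mulgr G a y) (cf _)).
Qed.

(** With [nu] the law [mu_t] this is the operator [P_t] of the overview. *)
Definition conv_op nu f (x : G) : R := \int[nu]_y f (x * (y : G))%g.

Lemma conv_op_bounds nu f m M : continuous f ->
  (forall x, m <= f x <= M) -> forall x, m <= conv_op nu f x <= M.
Proof.
move=> cf fmM x; have cx := @continuous_shiftl x f cf.
rewrite -{1}(Rintegral_probability_cst nu m) -(Rintegral_probability_cst nu M).
apply/andP; split; apply: le_Rintegral => //;
  do ?[exact: continuous_integrable cx|
       by apply: continuous_integrable; exact: cst_continuous].
all: by move=> y _; case/andP: (fmM (x * y)%g).
Qed.

(** By associativity [(g * x) * y = g * (x * y)], so the bound on [f] applies under the integral and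
    is not weakened. *)
Lemma conv_op_left_osc nu f (g : G) e : continuous f ->
  (forall x, `|f (g * x)%g - f x| <= e) ->
  forall x, `|conv_op nu f (g * x)%g - conv_op nu f x| <= e.
Proof.
move=> cf fe x; rewrite /conv_op -RintegralB//;
  do ?[by apply: continuous_integrable; exact: continuous_shiftl].
rewrite -[leRHS]mulr1 -(fine_probability_setT nu).
apply: le_normr_Rintegral_cst => //.
- exact: probability_lty.
- apply: measurable_funB; apply: continuous_measurable_borel;
  exact: continuous_shiftl.
- by move=> y _; rewrite -mulgA.
Qed.

(** The detour through left moduli replaces a limit under the integral sign. *)
Lemma conv_op_continuous nu f : continuous f -> continuous (conv_op nu f).
Proof.
move=> cf; apply: left_unif_continuous => e e0.
have := continuous_left_unif G_compact cf e0.
by apply: filterS => g ge; exact: conv_op_left_osc.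
Qed.

Lemma mulr_size_sum (I : Type) (s : seq I) (c : R) :
  c * (size s)%:R = \sum_(t <- s) c.
Proof. by rewrite big_const_seq count_predT iter_addr_0 mulr_natr. Qed.

(** Repetitions in [s] are allowed and act as weights, so the indices may come from any finite
    choice of times. *)
Definition mean_op (I : Type) (nu : I -> probability (borel G) R) (s : seq I) f
    (x : G) : R :=
  (\sum_(t <- s) conv_op (nu t) f x) / (size s)%:R.

Section mean_op.
Context {I : eqType} (nu : I -> probability (borel G) R).

Lemma mean_op_ge (s : seq I) f m M : continuous f -> (0 < size s)%N ->
  (forall x, m <= f x <= M) -> forall x, m <= mean_op nu s f x <= M.
Proof.
move=> cf s0 fmM x; rewrite /mean_op ler_pdivlMr ?ltr0n// ler_pdivrMr ?ltr0n//.
rewrite !mulr_size_sum.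
by apply/andP; split; apply: ler_sum => t _; case/andP: (conv_op_bounds (nu t) cf fmM x).
Qed.

Lemma mean_op_left_osc (s : seq I) f (g : G) e : continuous f -> (0 < size s)%N ->
  (forall x, `|f (g * x)%g - f x| <= e) ->
  forall x, `|mean_op nu s f (g * x)%g - mean_op nu s f x| <= e.
Proof.
move=> cf s0 fe x; rewrite /mean_op -mulrBl -sumrB normrM.
rewrite [X in _ * X]ger0_norm ?invr_ge0// ler_pdivrMr ?ltr0n//.
apply: (le_trans (ler_norm_sum _ _ _)).
rewrite mulr_size_sum.
by apply: ler_sum => t _; exact: conv_op_left_osc.
Qed.

Lemma mean_op_continuous (s : seq I) f : continuous f -> (0 < size s)%N ->
  continuous (mean_op nu s f).
Proof.
move=> cf s0; apply: left_unif_continuous => e e0.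
have := continuous_left_unif G_compact cf e0.
by apply: filterS => g ge; exact: mean_op_left_osc.
Qed.

End mean_op.

End convolution.

(** * Doeblin contraction by a finite mean of operators *)

Section contraction.
Context {R : realType} {G : topologicalGroupType}.
Hypotheses (G_compact : compact [set: G]) (G_metrizable : metrizable R G).
Context {J : eqType} (D : set J) (nu : J -> probability (borel G) R).
Hypothesis nu_dense : forall U : set G, open U -> U !=set0 ->
  exists2 t, D t & (0 < nu t U)%E.

(** Right translates of [W] fit left moduli: [W (x * z^-1)] writes [x] as [g * z] with [g] in [W],
    so a function with modulus [W] differs little at [x] and at [z]. *)
Lemma translates_finite_net (W : set G) : open W -> W 1%g ->
  exists s : seq G, forall x, exists2 z, z \in s & W (x * z^-1)%g.
Proof.
move=> oW W1; have := G_compact; rewrite compact_cover.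
move=> /(_ G setT (fun z => [set x | W (x * z^-1)%g])) [|x _|s _ cs].
- by move=> z _; have /continuousP := @continuous_mulgr G (z^-1)%g; apply.
- by exists x => //=; rewrite mulgV.
- by exists (finmap.enum_fset s) => x; have [z zs Wz] := cs x I; exists z.
Qed.

(** The cap at [1] serves the empty list and later keeps the contraction constant [k] below [1]. *)
Lemma seq_pos_lower_bound (T : eqType) (s : seq T) (u : T -> R) :
  (forall x, x \in s -> 0 < u x) -> exists2 e, 0 < e <= 1 & forall x, x \in s -> e <= u x.
Proof.
elim: s => [|x s ih] u0; first by exists 1; rewrite ?ltr01 ?lexx.
have [|e /andP[e0 e1] eu] := ih; first by move=> y ys; apply: u0; rewrite inE ys orbT.
exists (Num.min e (u x)) => [|y].
  by rewrite lt_min e0 u0 ?mem_head// ge_min e1.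
rewrite inE => /predU1P[->|ys]; rewrite ge_min ?lexx ?orbT//.
by rewrite eu.
Qed.

(** The supremum goes down when [f] is at most the midpoint of [[m, M]] somewhere:
    from any [x], some measure of the family charges the [y] such that [x * y] is
    [W]-close to that point. Otherwise the lower bound goes up to the midpoint. *)
Lemma mean_op_contraction (W : set G) : open W -> W 1%g ->
  exists (s : seq J) (k : R), [/\ (0 < size s)%N, forall t, t \in s -> D t, 0 < k < 1 &
    forall (f : G -> R) (e m M : R), continuous f ->
      (forall g x, W g -> `|f (g * x)%g - f x| <= e) ->
      (forall x, m <= f x <= M) -> 8 * e <= M - m ->
      exists m' M', (forall x, m' <= mean_op nu s f x <= M') /\
        M' - m' <= (1 - k) * (M - m)].
Proof.
move=> oW W1; have [z hz] := translates_finite_net oW W1.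
(* [A (a, b)] consists of the [y] that carry the net point [a] into the translate of [W] by the net
   point [b]. Only finitely many such sets occur, whence the common lower bound [eta] of their
   masses. *)
pose A (p : G * G) : set G := [set y | W (p.1 * y * p.2^-1)%g].
have oA p : open (A p).
  have : continuous (fun y => p.1 * y * p.2^-1)%g.
    by move=> y; apply: cvg_mulg; [exact: continuous_mulgl|exact: cvg_cst].
  by move/continuousP; apply.
have A0 p : A p !=set0 by exists (p.1^-1 * p.2)%g; rewrite /A/= mulVKg mulgV.
have ex_t (p : G * G) : exists i : J, D i /\ (0 < nu i (A p))%E.
  by have [i Di i0] := nu_dense (oA p) (A0 p); exists i.
have [t ht] := choice ex_t.
have nuA p : (nu (t p) (A p)) = (fine (nu (t p) (A p)))%:E.
  by rewrite fineK// fin_num_measure//; exact: open_borel.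
pose zz := [seq (a, b) | a <- z, b <- z].
have [|eta /andP[eta0 eta1] heta] := @seq_pos_lower_bound _ zz
  (fun p => fine (nu (t p) (A p))).
  by move=> p _; rewrite -lte_fin -nuA; exact: (ht p).2.
have z0 : (0 < size z)%N by have [a] := hz 1%g; case: (z).
have zz0 : (0 < size zz)%N by rewrite size_allpairs muln_gt0 z0.
pose s := map t zz; pose n : R := (size s)%:R.
have s0 : (0 < size s)%N by rewrite size_map.
have n1 : 1 <= n by rewrite ler1n.
have n0 : 0 < n by rewrite ltr0n.
(* One of the [n] operators lowers the upper bound by [eta / 8] of the oscillation; averaging with
   the others divides this gain by [n]. *)
have k01 : 0 < eta / (8 * n) <= 2^-1.
  rewrite divr_gt0 ?mulr_gt0//= ler_pdivrMr ?mulr_gt0//.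
  by rewrite (le_trans eta1)//; lra.
exists s, (eta / (8 * n)); split => //.
- by move=> i /mapP[p _ ->]; exact: (ht p).1.
- by move: k01 => /andP[-> /le_lt_trans]; apply; rewrite invf_lt1// ltr1n.
move=> f e m M cf fe fmM eM.
have e0 : 0 <= e by have := fe 1%g 1%g W1; rewrite mul1g subrr normr0.
pose mid := (m + M) / 2.
have [[x0 fx0]|/forallNP mid_lt] := pselect (exists x, f x <= mid); last first.
  exists mid, M; split.
    apply: mean_op_ge => // x; have /negP := mid_lt x; rewrite -ltNge => /ltW ->.
    by case/andP: (fmM x).
  have -> : M - mid = 2^-1 * (M - m) by rewrite /mid; field.
  by apply: ler_wpM2r; [lra|move/andP: k01 => [_]; lra].
exists m, (M - eta / (8 * n) * (M - m)); split; last by lra.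
move=> x; have /andP[-> _] /= := mean_op_ge G_compact nu cf s0 fmM x.
have [b bz Wb] := hz x0; have [a az Wa] := hz x.
have abzz : (a, b) \in zz by apply/allpairsP; exists (a, b).
have fb : f b <= mid + e.
  by have := fe _ b Wb; rewrite mulgVK ler_norml => /andP[]; lra.
(* Three moves cost [e] each: from [x * y] to [a * y], from there to [b], and from [b] to [x0],
   where [f] is at most [mid]. *)
have fxy y : A (a, b) y -> f (x * y)%g <= mid + 3 * e.
  rewrite /A /= => Ay.
  have := fe _ b Ay; rewrite mulgVK ler_norml => /andP[h1 h2].
  have := fe _ (a * y)%g Wa; rewrite mulgA mulgVK ler_norml => /andP[h3 h4].
  lra.
have main : conv_op (nu (t (a, b))) f x <= M - eta / 8 * (M - m).
  have mA := open_borel (oA (a, b)).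
  pose c := M - mid - 3 * e.
  (* The origin of [8]: [M - mid] is half the oscillation and [3 * e] is at most three eighths of
     it. *)
  have c_ge : (M - m) / 8 <= c by rewrite /c /mid; lra.
  have c0 : 0 <= c by lra.
  apply: (@le_trans _ _ (\int[nu (t (a, b))]_(y in [set: borel G])
      (M - c * \1_(A (a, b)) y))).
    apply: le_Rintegral => //.
    - exact: (continuous_integrable G_compact _ (@continuous_shiftl _ _ x f cf)).
    - apply: (le_integrable_cst (C := `|M| + `|c|)) => //.
      + exact: probability_lty.
      + apply: measurable_funB; first exact: measurable_cst.
        by apply: measurable_funM; [exact: measurable_cst|exact: measurable_indic].
      + move=> y _; rewrite (le_trans (ler_normB _ _))// lerD2l normrM.
        by rewrite ler_piMr// indicE; case: (_ \in _); rewrite ?normr1 ?normr0.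
    - move=> y _; have /andP[_ fM] := fmM (x * y)%g.
      rewrite indicE; case: (boolP (y \in A (a, b))) => [|_]; last by rewrite mulr0 subr0.
      by rewrite inE => /fxy; rewrite mulr1 /c; lra.
  have i1 : (nu (t (a, b))).-integrable [set: borel G]
      (EFin \o (\1_(A (a, b)) : borel G -> R)).
    exact: integrable_indic.
  rewrite RintegralB//; last 2 first.
  - exact: finite_measure_integrable_cst.
  - by apply: (integrableZl measurableT c i1).
  rewrite Rintegral_probability_cst RintegralZl//.
  rewrite /Rintegral integral_indic// setIT.
  have := heta _ abzz; set p := fine _ => etap.
  rewrite lerD2l lerN2 (_ : eta / 8 * (M - m) = (M - m) / 8 * eta); last by field.
  by apply: ler_pM => //; lra.
rewrite /mean_op ler_pdivrMr// mulrBl -/n.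
rewrite (_ : eta / _ * _ * n = eta / 8 * (M - m)); last by field; rewrite gt_eqF.
rewrite /n mulr_size_sum.
have tabs : t (a, b) \in s by exact: map_f.
(* The term at [t (a, b)] carries the gain; the others are bounded by [M]. *)
rewrite (big_rem _ tabs)/= [in leRHS](big_rem _ tabs)/= addrAC lerD//.
by apply: ler_sum => i _; case/andP: (conv_op_bounds G_compact (nu i) cf fmM x).
Qed.

(** [Q] stands for what an application has to carry from [f] to its iterates. The iteration stops
    once the oscillation is at most [e], and geometric decay brings it there. *)
Lemma mean_op_near_cst (Q : (G -> R) -> Prop) (f : G -> R) :
  continuous f -> Q f ->
  (forall g s, continuous g -> (0 < size s)%N -> (forall t, t \in s -> D t) ->
    Q g -> Q (mean_op nu s g)) ->
  forall e, 0 < e -> exists g c, [/\ continuous g, Q g & forall x, `|g x - c| <= e].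
Proof.
(* With modulus [e / 8] the contraction applies exactly as long as the oscillation is at least
   [e]. *)
move=> cf Qf QM e e0; have e8 : 0 < e / 8 by rewrite divr_gt0.
have : nbhs (1%g : G) [set g | forall x, `|f (g * x)%g - f x| <= e / 8].
  exact: continuous_left_unif G_compact _ cf _ e8.
rewrite nbhsE => -[W [oW W1] fW].
have [s [k [s0 sD /andP[k0 k1] contr]]] := mean_op_contraction oW W1.
have [C fC] := compact_continuous_bounded G_compact cf.
have step n : exists g m M, [/\ continuous g, Q g,
    forall a x, W a -> `|g (a * x)%g - g x| <= e / 8,
    forall x, m <= g x <= M & M - m <= e \/ M - m <= (1 - k) ^+ n * (2 * C)].
  elim: n => [|n [g [m [M [cg Qg gW gmM Mm]]]]].
    exists f, (- C), C; split => //.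
    - by move=> a x /fW.
    - by move=> x; rewrite -ler_norml.
    - by right; rewrite expr0 mul1r; lra.
  have [Mme|/ltW eMm] := leP (M - m) e; first by exists g, m, M; split => //; left.
  have [|m' [M' [gmM' Mm']]] := contr g (e / 8) m M cg gW gmM; first by lra.
  exists (mean_op nu s g), m', M'; split => //.
  - exact: mean_op_continuous.
  - exact: QM.
  - by move=> a x Wa; apply: mean_op_left_osc => // y; exact: gW.
  - case: Mm => Mm; first by left; nra.
    right; rewrite exprS -mulrA (le_trans Mm')//.
    by apply: ler_wpM2l => //; lra.
have [n hn] : exists n, (1 - k) ^+ n * (2 * C) <= e.
  have : (1 - k) ^+ n * (2 * C) @[n --> \oo] --> (0 : R).
    rewrite -[X in _ --> X](mul0r (2 * C)); apply: cvgM; last exact: cvg_cst.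
    by apply: cvg_expr; rewrite ger0_norm; lra.
  move=> /cvgrPdist_le/(_ e e0)[n _ hn]; exists n.
  by have := hn n (leqnn n); rewrite sub0r normrN => /(le_trans (ler_norm _)).
have [g [m [M [cg Qg _ gmM Mm]]]] := step n.
exists g, m; split => // x; have /andP[mg gM] := gmM x.
by rewrite ger0_norm; case: Mm; lra.
Qed.

End contraction.

(** * Invariance of the Haar integral under translations, inversion and convolution *)

Section haar.
Context {R : realType} {G : topologicalGroupType}.
Hypotheses (G_compact : compact [set: G]) (G_metrizable : metrizable R G).

Lemma continuous_Fubini (nu1 nu2 : probability (borel G) R) (F : G * G -> R) :
  continuous F -> (exists C, forall z, `|F z| <= C) ->
  \int[nu1]_(x in [set: borel G]) \int[nu2]_(y in [set: borel G]) F (x : G, y : G) =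
  \int[nu2]_(y in [set: borel G]) \int[nu1]_(x in [set: borel G]) F (x : G, y : G).
Proof.
move=> cF [C FC].
apply: (@Rintegral_Fubini _ _ _ _ _ nu1 nu2 setT setT F C) => //.
- exact: probability_lty.
- exact: probability_lty.
- exact: continuous_measurable_prod G_compact G_metrizable _ cF.
Qed.

Variable lambda : probability (borel G) R.
Hypothesis lambda_haar : is_haar lambda.

Lemma haar_mull (a : G) (f : G -> R) : continuous f ->
  \int[lambda]_(x in [set: borel G]) f (a * (x : G))%g =
  \int[lambda]_(x in [set: borel G]) f x.
Proof.
move=> cf; pose h (x : borel G) : borel G := (a * (x : G))%g.
have mh : measurable_fun setT h.
  by apply: continuous_measurable_self; exact: continuous_mulgl.
have mf : measurable_fun setT (EFin \o (f : borel G -> R)).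
  by apply/measurable_EFinP; exact: continuous_measurable_borel.
have fh : lambda.-integrable (h @^-1` setT) ((EFin \o (f : borel G -> R)) \o h).
  rewrite preimage_setT.
  exact: (continuous_integrable G_compact _ (@continuous_shiftl _ _ a f cf)).
have := integral_pushforward mh mf fh measurableT.
rewrite preimage_setT /Rintegral => H; congr fine.
rewrite -[LHS]H; apply: eq_measure_integral => A mA _.
transitivity (lambda [set (a^-1 * x)%g | x in (A : set G)]); last exact: lambda_haar.
rewrite /pushforward; congr (lambda _).
apply/seteqP; split => [x Ax|_ [y Ay <-]].
  by exists (a * (x : G))%g => //; rewrite mulKg.
by rewrite /h /= mulVKg.
Qed.

(** Integrate [f (x^-1 * y)] in both orders. *)
Lemma haar_inv (f : G -> R) : continuous f ->
  \int[lambda]_(x in [set: borel G]) f (x : G)^-1%g =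
  \int[lambda]_(x in [set: borel G]) f x.
Proof.
move=> cf; have [C fC] := compact_continuous_bounded G_compact cf.
have cF : continuous (fun z : G * G => f (z.1^-1 * z.2)%g).
  move=> z; exact: (@cvg_comp _ _ _ (fun z : G * G => (z.1^-1 * z.2)%g) f _ _ _
    (@continuous_divgl G z) (cf _)).
have FC : exists C, forall z : G * G, `|f (z.1^-1 * z.2)%g| <= C by exists C.
have := continuous_Fubini lambda lambda cF FC => /=.
under eq_Rintegral do rewrite (haar_mull _ cf).
rewrite Rintegral_probability_cst => ->.
rewrite -[LHS](Rintegral_probability_cst lambda); apply: eq_Rintegral => y _.
have cg : continuous (fun x : G => f (x^-1 * y)%g).
  move=> x; apply: (@cvg_comp _ _ _ (fun x : G => (x^-1 * y)%g) f _ _ _ _ (cf _)).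
  by apply: cvg_mulg; [exact: invg_continuous|exact: cvg_cst].
rewrite -(haar_mull y cg); apply: eq_Rintegral => x _ /=.
by rewrite invgM mulgVK.
Qed.

(** The hypothesis gives left invariance, while [conv_op] translates on the right; inversion
    exchanges the two sides. *)
Lemma haar_mulr (a : G) (f : G -> R) : continuous f ->
  \int[lambda]_(x in [set: borel G]) f ((x : G) * a)%g =
  \int[lambda]_(x in [set: borel G]) f x.
Proof.
move=> cf; rewrite -(haar_inv (@continuous_shiftr _ _ a f cf)) -(haar_inv cf).
have cg : continuous (fun x : G => f (x^-1)%g).
  move=> x; exact: (@cvg_comp _ _ _ (fun x : G => (x^-1)%g) f _ _ _
    (@invg_continuous G x) (cf _)).
rewrite -(haar_mull a^-1%g cg); apply: eq_Rintegral => x _.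
by rewrite invgM invgK.
Qed.

Lemma haar_conv_op (nu : probability (borel G) R) (f : G -> R) : continuous f ->
  \int[lambda]_(x in [set: borel G]) conv_op nu f x =
  \int[lambda]_(x in [set: borel G]) f x.
Proof.
move=> cf; have [C fC] := compact_continuous_bounded G_compact cf.
have cF : continuous (fun z : G * G => f (z.1 * z.2)%g).
  move=> z; exact: (@cvg_comp _ _ _ (fun z : G * G => (z.1 * z.2)%g) f _ _ _
    (@mulg_continuous G z) (cf _)).
have FC : exists C, forall z : G * G, `|f (z.1 * z.2)%g| <= C by exists C.
have := continuous_Fubini lambda nu cF FC; rewrite /conv_op => -> /=.
under eq_Rintegral do rewrite (haar_mulr _ cf).
by rewrite Rintegral_probability_cst.
Qed.

Lemma haar_mean_op (I : eqType) (nu : I -> probability (borel G) R) (s : seq I)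
    (f : G -> R) : continuous f -> (0 < size s)%N ->
  \int[lambda]_(x in [set: borel G]) mean_op nu s f x =
  \int[lambda]_(x in [set: borel G]) f x.
Proof.
move=> cf s0; rewrite /mean_op.
have ci t := continuous_integrable G_compact lambda
  (@conv_op_continuous _ _ G_compact (nu t) f cf).
have csum r : lambda.-integrable setT
    (EFin \o (fun x : borel G => \sum_(t <- r) conv_op (nu t) f x)).
  apply: continuous_integrable => //; elim: r => [|t r ih].
    by under eq_fun do rewrite big_nil; exact: cst_continuous.
  under eq_fun do rewrite big_cons.
  by move=> x; apply: cvgD; [exact: conv_op_continuous|exact: ih].
rewrite RintegralZr// (_ : \int[lambda]_x _ =
  (\int[lambda]_(x in [set: borel G]) f x) * (size s)%:R).
  by rewrite mulfK// pnatr_eq0 -lt0n.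
rewrite mulr_size_sum; elim: (s) => [|t r ih].
  under eq_Rintegral do rewrite big_nil.
  by rewrite Rintegral_probability_cst big_nil.
under eq_Rintegral do rewrite big_cons.
by rewrite RintegralD// ih big_cons haar_conv_op.
Qed.

End haar.

(** * Tools for almost sure convergence of time averages *)

Section law_of_large_numbers.
Context {R : realType}.

Lemma sum_inv_square_le (n : nat) : \sum_(0 <= i < n) (i.+1%:R ^- 2) <= 2 :> R.
Proof.
case: n => [|n]; first by rewrite big_nil.
(* The strengthened bound goes through the induction because [1/x - 1/(x+1)] is at least the square
   of [1/(x+1)]. *)
suff : \sum_(0 <= i < n.+1) (i.+1%:R ^- 2) <= 2 - n.+1%:R^-1 :> R.
  by move/le_trans; apply; rewrite gerBl.
elim: n => [|n ih]; first by rewrite big_nat1 expr1n invr1; lra.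
rewrite big_nat_recr//= (le_trans (lerD ih (lexx _)))//.
rewrite -subr_ge0 -(natr1 n.+1); set x : R := n.+1%:R.
have x0 : 0 < x by rewrite ltr0n.
have -> : 2 - (x + 1)^-1 - (2 - x^-1 + (x + 1) ^- 2) = x^-1 * (x + 1) ^- 2.
  by field; rewrite !gt_eqF//; lra.
by rewrite mulr_ge0// ?invr_ge0 ?exprn_ge0//; lra.
Qed.

(** Between consecutive squares [m] changes by [O(sqrt T)], which is negligible after division by
    [T]. *)
Lemma cvg_average_subsequence (m : R -> R) (C : R) :
  (forall s t, 0 <= s -> s <= t -> `|m t - m s| <= C * (t - s)) ->
  m (n.+1%:R ^+ 2) / n.+1%:R ^+ 2 @[n --> \oo] --> (0 : R) ->
  T^-1 * m T @[T --> +oo] --> (0 : R).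
Proof.
move=> mC m0; apply/cvgrPdist_le => e e0.
have C0 : 0 <= C.
  by have := mC 0 1 (lexx _) ler01; rewrite subr0 mulr1; apply: le_trans.
have e2 : 0 < e / 2 by rewrite divr_gt0.
move/cvgrPdist_le : m0 => /(_ _ e2)[n0 _ hn0].
have : C * 3 * harmonic n @[n --> \oo] --> (0 : R).
  rewrite -[X in _ --> X](mulr0 (C * 3)); apply: cvgM; first exact: cvg_cst.
  exact: cvg_harmonic.
move=> /cvgrPdist_le/(_ _ e2)[n1 _ hn1].
near=> T.
have T1 : 1 <= T by near: T; exact: nbhs_pinfty_ge.
have T0 : 0 < T by lra.
have sT1 : 1 <= Num.sqrt T by rewrite -sqrtr1 ler_sqrt.
have sT0 : 0 <= Num.sqrt T by rewrite sqrtr_ge0.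
(* With [x = k.+1] the integer part of the square root of [T], the gap [T - x ^+ 2] is at most
   [2 * x + 1], hence at most [3 * x]. *)
have [k kT] : exists k, Num.truncn (Num.sqrt T) = k.+1.
  by exists (Num.truncn (Num.sqrt T)).-1; rewrite prednK// truncn_ge_nat.
have /andP[k1 k2] := truncn_itv sT0; rewrite kT in k1 k2.
set x : R := k.+1%:R in k1.
have x1 : 1 <= x by rewrite ler1n.
have xT : x ^+ 2 <= T by rewrite -(sqr_sqrtr (ltW T0)) ler_sqr ?nnegrE//; lra.
have Tx : T <= (x + 1) ^+ 2.
  rewrite -(sqr_sqrtr (ltW T0)) ler_sqr ?nnegrE//; first by rewrite natr1 ltW.
  by lra.
have nk : (maxn n0 n1 <= k)%N.
  rewrite -ltnS -kT truncn_ge_nat// -(ger0_norm sT0) -sqrtr_sqr.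
  rewrite -(@ger0_norm _ (maxn n0 n1).+1%:R)// -sqrtr_sqr ler_wsqrtr// sqr_sqrtr; last by lra.
  by near: T; exact: nbhs_pinfty_ge.
move: nk; rewrite geq_max => /andP[/hn0 + /hn1].
rewrite /= !sub0r !normrN -/x => h1 h2.
rewrite normrM normfV (ger0_norm (ltW T0)) ler_pdivrMl//.
have h3 := mC (x ^+ 2) T (sqr_ge0 _) xT.
have h4 : `|m (x ^+ 2)| <= e / 2 * x ^+ 2.
  by move: h1; rewrite normrM normfV (ger0_norm (sqr_ge0 _)) ler_pdivrMr// exprn_gt0//; lra.
have h5 : C * 3 <= e / 2 * x.
  move: h2; rewrite ger0_norm; last by rewrite mulr_ge0// ?mulr_ge0// invr_ge0.
  by rewrite /harmonic -/x ler_pdivrMr//; lra.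
have h6 : `|m T| <= `|m (x ^+ 2)| + `|m T - m (x ^+ 2)|.
  by rewrite (le_trans _ (ler_normD _ _))// addrC subrK.
have h7 : C * (T - x ^+ 2) <= C * 3 * x by nra.
have h8 : C * 3 * x <= e / 2 * x ^+ 2 by nra.
have h9 : e / 2 * x ^+ 2 <= e / 2 * T by nra.
by lra.
Unshelve. all: by end_near.
Qed.

Context {d : measure_display} {Omega : measurableType d} (P : probability Omega R).

(** The sum of the series has expectation at most [K], so it is almost surely finite and its terms
    tend to [0]; this takes the place of a Borel-Cantelli argument. *)
Lemma ae_cvg0_summable (Z : nat -> Omega -> R) (u : nat -> R) (K : R) :
  (forall n, measurable_fun setT (Z n)) -> (forall n w, 0 <= Z n w) ->
  (forall n, (\int[P]_w (Z n w)%:E <= (u n)%:E)%E) ->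
  (forall n, \sum_(0 <= i < n) u i <= K) ->
  {ae P, forall w, Z n w @[n --> \oo] --> (0 : R)}.
Proof.
move=> mZ Z0 Zu uK.
pose S w := (\sum_(n <oo) (Z n w)%:E)%E.
have mZE n : measurable_fun setT (fun w => (Z n w)%:E) by exact/measurable_EFinP.
have S0 w : (0 <= S w)%E by apply: nneseries_ge0 => n _ _; rewrite lee_fin.
have mS : measurable_fun setT S.
  by apply: ge0_emeasurable_sum => // n w _ _; rewrite lee_fin.
have iS : P.-integrable setT S.
  apply/integrableP; split => //.
  under eq_integral do rewrite gee0_abs//.
  rewrite integral_nneseries//; last by move=> n w _; rewrite lee_fin.
  apply: (@le_lt_trans _ _ K%:E); last exact: ltry.
  have ge0 n : (0 <= \int[P]_w (Z n w)%:E)%E.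
    by apply: integral_ge0 => w _; rewrite lee_fin.
  apply: lime_le.
    by apply: is_cvg_nneseries => n _ _; exact: ge0.
  apply: nearW => n; apply: (@le_trans _ _ (\sum_(0 <= i < n) (u i)%:E)%E).
    by apply: lee_sum => i _; exact: Zu.
  by rewrite sumEFin lee_fin.
have := integrable_ae measurableT iS.
apply: filterS => w /(_ I) Sw.
apply: cvg_series_cvg_0; apply: nnseries_is_cvg => //.
by rewrite -ge0_fin_numE//; exact: S0.
Qed.

End law_of_large_numbers.

(** * Time averages of processes orthogonal at distance [h] *)

Section second_moment.
Context {R : realType} {d : measure_display} {Omega : measurableType d}.
Variables (P : probability Omega R) (D : R * Omega -> R) (C h : R).
Hypotheses (mD : measurable_fun setT D) (DC : forall z, `|D z| <= C) (h0 : 0 <= h).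
Hypothesis D_orth : forall s t, 0 <= s -> s + h <= t ->
  \int[P]_w (D (s, w) * D (t, w)) = 0.

Local Notation leb := (@lebesgue_measure R).

Let M (T : R) (w : Omega) : R := \int[leb]_(t in `[0, T]) D (t, w).

Let C0 : 0 <= C. Proof. by apply: le_trans (DC (0, point)); rewrite normr_ge0. Qed.

Lemma lebesgue_measure_itv_lty (x y : bool) (a b : R) :
  (leb [set` Interval (BSide x a) (BSide y b)] < +oo)%E.
Proof. by rewrite lebesgue_measure_itv /=; case: ifP => _; rewrite ?ltry// -EFinB ltry. Qed.

Lemma fine_lebesgue_measure_itv (a b : R) : a <= b -> fine (leb `[a, b]) = b - a.
Proof.
rewrite lebesgue_measure_itv /= le_eqVlt lte_fin => /predU1P[->|->//].
by rewrite ltxx subrr.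
Qed.

Let mDt t : measurable_fun setT (fun w => D (t, w)).
Proof. by apply: measurableT_comp mD _; exact: pair1_measurable. Qed.

Let mDw w : measurable_fun setT (fun t => D (t, w)).
Proof. by apply: measurableT_comp mD _; exact: pair2_measurable. Qed.

Let mM T : measurable_fun setT (M T).
Proof.
apply: (@measurable_fun_Rintegral2 _ _ _ _ _ leb P `[0, T]%classic setT D C) => //.
- exact: lebesgue_measure_itv_lty.
- exact: probability_lty.
Qed.

Let M_bound T w : 0 <= T -> `|M T w| <= C * T.
Proof.
move=> T0; rewrite -[X in _ * X](subr0 T) -fine_lebesgue_measure_itv//.
apply: le_normr_Rintegral_cst => //; first exact: lebesgue_measure_itv_lty.
exact: measurable_funTS (mDw w).
Qed.

Let orth s t : 0 <= s -> 0 <= t -> h <= `|t - s| ->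
  \int[P]_w (D (s, w) * D (t, w)) = 0.
Proof.
move=> s0 t0; have [st|ts] := leP s t.
  by rewrite ger0_norm ?subr_ge0// => hts; apply: D_orth => //; lra.
rewrite ltr0_norm ?subr_lt0// => hts.
by under eq_Rintegral do rewrite mulrC; apply: D_orth => //; lra.
Qed.

Let DD_bound s t : `|\int[P]_w (D (s, w) * D (t, w))| <= C ^+ 2.
Proof.
have -> : C ^+ 2 = C ^+ 2 * fine (P setT) by rewrite probability_setT mulr1.
apply: le_normr_Rintegral_cst => //; first exact: probability_lty.
  by apply: measurable_funM.
by move=> w _; rewrite normrM expr2 ler_pM.
Qed.

(** The integrand of [M T] only contributes on [[t - h, t + h]]. *)
Let DM_bound T t : 0 <= T -> 0 <= t ->
  `|\int[P]_w (D (t, w) * M T w)| <= C ^+ 2 * (2 * h).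
Proof.
move=> T0 t0.
pose g s := \int[P]_w (D (t, w) * D (s, w)).
have mF : measurable_fun setT (fun z : R * Omega => D (t, z.2) * D z).
  by apply: measurable_funM => //; exact: measurableT_comp (mDt t) measurable_snd.
have FC (z : R * Omega) : `|D (t, z.2) * D z| <= C ^+ 2.
  by rewrite normrM expr2 ler_pM.
have mg : measurable_fun `[0, T] g.
  apply: (@measurable_fun_Rintegral1 _ _ _ _ _ leb P `[0, T]%classic setT
    (fun z => D (t, z.2) * D z) (C ^+ 2)) => //.
  - exact: lebesgue_measure_itv_lty.
  - exact: probability_lty.
have -> : \int[P]_w (D (t, w) * M T w) = \int[leb]_(s in `[0, T]) g s.
  rewrite /g (@Rintegral_Fubini _ _ _ _ _ leb P `[0, T]%classic setT
    (fun z => D (t, z.2) * D z) (C ^+ 2))//; last 2 first.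
  - exact: lebesgue_measure_itv_lty.
  - exact: probability_lty.
  apply: eq_Rintegral => w _; rewrite /M /= RintegralZl//.
  apply: (le_integrable_cst (C := C)) => //; first exact: lebesgue_measure_itv_lty.
  exact: measurable_funTS (mDw w).
have -> : \int[leb]_(s in `[0, T]) g s =
    \int[leb]_(s in `[0, T] `&` `[t - h, t + h]) g s.
  rewrite Rintegral_mkcondr; apply: eq_Rintegral => s; rewrite inE/= in_itv/= => /andP[s0 _].
  rewrite patchE; case: ifPn => //; rewrite notin_setE/= in_itv/= => /negP hs.
  apply: orth => //; rewrite leNgt; apply: contra hs.
  by rewrite ltr_norml => /andP[h1 h2]; apply/andP; split; lra.
have hoo := lebesgue_measure_itv_lty true false (t - h) (t + h).
pose I0 := `[0, T]%classic; pose Ih := `[t - h, t + h]%classic.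
have leh : (leb (I0 `&` Ih) <= leb Ih)%E.
  by apply: le_measure; rewrite ?inE; [apply: measurableI; exact: measurable_itv|exact: measurable_itv|exact: subIsetr].
apply: (le_trans (le_normr_Rintegral_cst (C := C ^+ 2) _ _ _ _)) => //.
- by apply: measurableI; exact: measurable_itv.
- exact: le_lt_trans leh hoo.
- by apply: measurable_funS mg => //; exact: subIsetl.
- by move=> s _; exact: DD_bound.
- rewrite ler_wpM2l ?sqr_ge0//.
  rewrite (_ : 2 * h = fine (leb `[t - h, t + h])); last first.
    have th : t - h <= t + h by rewrite lerD2l; have := h0; lra.
    by rewrite fine_lebesgue_measure_itv//; ring.
  rewrite fine_le// ge0_fin_numE//; exact: le_lt_trans leh hoo.
Qed.

(** Only one factor of the square is written as a time integral and brought outside the expectation;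
    the bound for the rest is uniform in [t], so the growth is linear in [T]. *)
Lemma second_moment_le T : 0 <= T ->
  \int[P]_w (M T w ^+ 2) <= C ^+ 2 * (2 * h) * T.
Proof.
move=> T0.
have mF : measurable_fun setT (fun z : R * Omega => D z * M T z.2).
  by apply: measurable_funM => //; exact: measurableT_comp (mM T) measurable_snd.
have FC (z : R * Omega) : `|D z * M T z.2| <= C * (C * T).
  by rewrite normrM ler_pM// M_bound.
have Too := lebesgue_measure_itv_lty true false 0 T.
have Poo := probability_lty P.
have -> : \int[P]_w (M T w ^+ 2) =
    \int[leb]_(t in `[0, T]) \int[P]_w (D (t, w) * M T w).
  rewrite (@Rintegral_Fubini _ _ _ _ _ leb P `[0, T]%classic setT
    (fun z => D z * M T z.2) (C * (C * T)))//.
  apply: eq_Rintegral => w _; rewrite /= RintegralZr//.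
  by apply: (le_integrable_cst (C := C)) => //; exact: measurable_funTS (mDw w).
rewrite (le_trans (ler_norm _))// -[X in _ * X](subr0 T) -fine_lebesgue_measure_itv//.
apply: le_normr_Rintegral_cst => //.
  exact: (@measurable_fun_Rintegral1 _ _ _ _ _ leb P `[0, T]%classic setT
    (fun z => D z * M T z.2) (C * (C * T))).
by move=> t /=; rewrite in_itv/= => /andP[t0 _]; exact: DM_bound.
Qed.

Lemma ae_average_cvg0 : {ae P, forall w,
  T^-1 * \int[leb]_(t in `[0, T]) D (t, w) @[T --> +oo] --> (0 : R)}.
Proof.
(* The mean square of the average over [[0, N n]] is at most [K / N n], which is summable; the shift
   of the index keeps [N n] positive. *)
pose N (n : nat) : R := n.+1%:R ^+ 2.
have N0 n : 0 < N n by rewrite exprn_gt0// ltr0n.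
pose Z n w := (M (N n) w / N n) ^+ 2.
have mZ n : measurable_fun setT (Z n).
  by apply: measurable_funX; apply: measurable_funM => //; exact: measurable_cst.
have ZE n w : Z n w = M (N n) w ^+ 2 * (N n ^- 2) by rewrite /Z exprMn exprVn.
have iM2 n : P.-integrable setT (EFin \o (fun w => M (N n) w ^+ 2)).
  apply: (le_integrable_cst (C := (C * N n) ^+ 2)) => //.
  - exact: probability_lty.
  - exact: measurable_funX.
  - move=> w _; rewrite normrX ler_sqr ?nnegrE ?mulr_ge0 ?(ltW (N0 n))//.
    exact/M_bound/ltW.
have iZ n : P.-integrable setT (EFin \o Z n).
  rewrite (_ : EFin \o Z n = EFin \o (fun w => M (N n) w ^+ 2 * (N n ^- 2))).
    apply: (le_integrable_cst (C := (C * N n) ^+ 2 * (N n ^- 2))) => //.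
    - exact: probability_lty.
    - by apply: measurable_funM => //; exact: measurable_funX.
    - move=> w _; rewrite normrM [X in _ * X]ger0_norm ?invr_ge0 ?exprn_ge0 ?(ltW (N0 n))//.
      rewrite ler_wpM2r ?invr_ge0 ?exprn_ge0 ?(ltW (N0 n))//.
      rewrite normrX ler_sqr ?nnegrE ?mulr_ge0 ?(ltW (N0 n))//.
      exact/M_bound/ltW.
  by apply/funext => w /=; rewrite ZE.
pose K := C ^+ 2 * (2 * h).
have K0 : 0 <= K by rewrite /K mulr_ge0 ?sqr_ge0// mulr_ge0.
suff : {ae P, forall w, Z n w @[n --> \oo] --> (0 : R)}.
  apply: filterS => w Zw; apply: (@cvg_average_subsequence _ (M^~ w) C).
    move=> s t s0 st; rewrite /M Rintegral_itvB ?bnd_simp//; last first.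
      apply: (le_integrable_cst (C := C)) => //; first exact: lebesgue_measure_itv_lty.
      exact: measurable_funTS (mDw w).
    have -> : t - s = fine (leb `]s, t]).
      rewrite lebesgue_measure_itv /= lte_fin; case: ltgtP st => // -> _.
      by rewrite subrr.
    apply: le_normr_Rintegral_cst => //.
      exact: lebesgue_measure_itv_lty.
    exact: measurable_funTS (mDw w).
  (* [Z] is the square of the average, hence the tolerance [e ^+ 2]. *)
  apply/cvgrPdist_le => e e0; move/cvgrPdist_le : Zw => /(_ _ (exprn_gt0 2 e0)).
  apply: filterS => n; rewrite !sub0r !normrN /Z normrX ler_sqr ?nnegrE//.
  exact: ltW.
apply: (@ae_cvg0_summable _ _ _ P Z (fun n => K * n.+1%:R ^- 2) (K * 2) mZ).
- by move=> n w; exact: sqr_ge0.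
- move=> n; rewrite -(fineK (integrable_fin_num measurableT (iZ n))) lee_fin.
  rewrite -/(Rintegral P setT (Z n)).
  rewrite (@eq_Rintegral _ _ _ P setT (fun w => M (N n) w ^+ 2 * (N n ^- 2)));
    last by move=> w _; exact: ZE.
  rewrite RintegralZr//.
  rewrite ler_pdivrMr ?exprn_gt0// (le_trans (second_moment_le (ltW (N0 n))))//.
  have -> : K * n.+1%:R ^- 2 * N n ^+ 2 = K * N n.
    by rewrite -[n.+1%:R ^- 2]/((N n)^-1); field; rewrite gt_eqF.
  by rewrite /K lexx.
- by move=> n; rewrite -mulr_sumr ler_wpM2l// sum_inv_square_le.
Qed.

End second_moment.

(** * Markov property and semigroup of a Lévy process *)

Section levy.
Context {R : realType} {G : topologicalGroupType}.
Hypotheses (G_compact : compact [set: G]) (G_metrizable : metrizable R G).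
Context {d : measure_display} {Omega : measurableType d} {P : probability Omega R}.

(** The product rule determines the joint law of [U] and [V] as a product measure. [nu] is kept
    apart from the distribution of [V] so that it can be the law [mu_t] of the elapsed time. *)
Lemma independent_Rintegral (U V : {mfun Omega >-> borel G}) (nu : probability (borel G) R)
    (F : G * G -> R) (C : R) :
  (forall A B, measurable A -> measurable B ->
    P (U @^-1` A `&` V @^-1` B) = (P (U @^-1` A) * nu B)%E) ->
  continuous F -> (forall z, `|F z| <= C) ->
  \int[P]_w F (U w : G, V w : G) =
  \int[P]_w \int[nu]_(y in [set: borel G]) F (U w : G, y : G).
Proof.
move=> UV cF FC.
pose UVm w := (U w, V w) : borel G * borel G.
have mUV : measurable_fun setT UVm by exact: measurable_fun_pair.
have mF : measurable_fun setT (F : borel G * borel G -> R).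
  exact: continuous_measurable_prod G_compact G_metrizable _ cF.
have Poo := probability_lty P.
have mFUV : measurable_fun setT (fun w => F (UVm w)) by exact: measurableT_comp.
pose law : probability (borel G) R := distribution P U.
have lawoo : (law setT < +oo)%E := probability_lty law.
have nuoo : (nu setT < +oo)%E := probability_lty nu.
transitivity (\int[(law \x nu)%E]_(z in [set: borel G * borel G]) F z).
  pose uvmfun : {mfun Omega >-> (borel G * borel G)%type} :=
    HB.pack UVm (isMeasurableFun.Build _ _ _ _ _ mUV).
  transitivity (\int[distribution P uvmfun]_(z in [set: borel G * borel G]) F z).
    rewrite /Rintegral; congr fine.
    have fi : P.-integrable (UVm @^-1` setT) ((EFin \o F) \o UVm).
      by rewrite preimage_setT; apply: (le_integrable_cst (C := C)).
    have mEF : measurable_fun setT (EFin \o (F : borel G * borel G -> R)).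
      exact/measurable_EFinP.
    by have := integral_pushforward mUV mEF fi measurableT; rewrite preimage_setT => <-.
  rewrite /Rintegral; congr fine; apply: eq_measure_integral => A mA _.
  by rewrite -(@product_measure_unique _ _ _ _ _ law nu (distribution P uvmfun)).
have := @Rintegral_product_measure _ _ _ _ _ law nu setT setT F C measurableT measurableT
  lawoo nuoo mF FC.
rewrite setXTT => <-.
pose g (x : borel G) := \int[nu]_(y in [set: borel G]) F (x : G, y : G).
have mg : measurable_fun setT g.
  exact: (@measurable_fun_Rintegral1 _ _ _ _ _ law nu setT setT F C).
rewrite /Rintegral -/(Rintegral _ _ _); congr fine.
have gC x : `|g x| <= C.
  rewrite -[leRHS]mulr1 -(fine_probability_setT nu).
  apply: le_normr_Rintegral_cst => //.
  by apply: measurableT_comp mF _; exact: pair1_measurable.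
have fi : P.-integrable (U @^-1` setT) ((EFin \o g) \o U).
  rewrite preimage_setT; apply: (le_integrable_cst (C := C)) => //.
  exact: measurableT_comp.
have mEg : measurable_fun setT (EFin \o g) by exact/measurable_EFinP.
have mU : measurable_fun setT U by [].
by have := integral_pushforward mU mEg fi measurableT; rewrite preimage_setT => <-.
Qed.

Context {X : R -> {RV P >-> borel G}} (X_levy : is_levy X).

Lemma measurable_increment s t : measurable_fun setT (increment X s t).
Proof.
by apply: (measurable_divgl G_compact G_metrizable); exact: measurable_funPT.
Qed.

Definition increment_mfun s t : {mfun Omega >-> borel G} :=
  HB.pack (increment X s t) (isMeasurableFun.Build _ _ _ _ _ (measurable_increment s t)).

Definition increment_law t : probability (borel G) R :=
  distribution P (increment_mfun 0 t).

Lemma increment_lawE s t A : 0 <= s -> s < t -> measurable A ->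
  P (increment X s t @^-1` A) = increment_law (t - s) A.
Proof. by move=> s0 st mA; exact: (levy_stationary X_levy). Qed.

Lemma levy_independent_increment u v A B : 0 <= u -> u < v ->
  measurable A -> measurable B ->
  P (X u @^-1` A `&` increment X u v @^-1` B) =
  (P (X u @^-1` A) * increment_law (v - u) B)%E.
Proof.
move=> u0 uv mA mB; rewrite -increment_lawE//.
(* Strict growth is only required from [t 0] to [t 1], so [t] may stay at [v] afterwards. *)
pose t (k : nat) : R := if k == 0%N then u else v.
have tlt k : (k <= 0)%N -> t k < t k.+1 by rewrite leqn0 => /eqP ->.
have := @levy_independent _ _ _ _ _ _ X_levy 0 t u0 tlt [set: 'I_2]%SET
  (fun i : 'I_2 => if val i == 0%N then A else B) _.
under eq_bigl do rewrite finset.in_setT.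
rewrite !big_ord_recl big_ord0 /= mule1 => <-; last first.
  by move=> i; case: ifP.
congr (P _); apply/seteqP; split => w /=.
  by move=> [Aw Bw] [[|[|//]] i2] _ /=.
move=> H; split; first exact: (H ord0 (finset.in_setT _)).
exact: (H (lift ord0 ord0) (finset.in_setT _)).
Qed.

Lemma levy_independent_increments a b A B : 0 < a -> 0 < b ->
  measurable A -> measurable B ->
  P (increment X 0 a @^-1` A `&` increment X a (a + b) @^-1` B) =
  (P (increment X 0 a @^-1` A) * increment_law b B)%E.
Proof.
move=> a0 b0 mA mB; rewrite -[b in increment_law b](addrK a) (addrC b).
rewrite -increment_lawE ?ltrDl//; last exact: ltW.
pose t (k : nat) : R := if k == 0%N then 0 else if k == 1%N then a else a + b.
have tlt k : (k <= 1)%N -> t k < t k.+1.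
  by case: k => [|[|//]] _; rewrite /t//= ltrDl.
(* The member [X 0] of the family gets the full event, which leaves the product rule for the two
   increments. *)
have := @levy_independent _ _ _ _ _ _ X_levy 1 t (lexx _) tlt [set: 'I_3]%SET
  (fun i : 'I_3 => if val i == 0%N then setT else if val i == 1%N then A else B) _.
under eq_bigl do rewrite finset.in_setT.
rewrite !big_ord_recl big_ord0 /= mule1 preimage_setT probability_setT mul1e.
move=> <-; last by move=> i; case: ifP => // _; case: ifP.
congr (P _); apply/seteqP; split => w /=.
  by move=> [Aw Bw] [[|[|[|//]]] i2] _ /=.
move=> H; split; first exact: (H (lift ord0 ord0) (finset.in_setT _)).
exact: (H (lift ord0 (lift ord0 ord0)) (finset.in_setT _)).
Qed.

Implicit Types (f a : G -> R).

Lemma mulX_increment s t w :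
  ((X s w : G) * (increment X s t w : G))%g = (X t w : G).
Proof. by rewrite /increment mulVKg. Qed.

Lemma continuous_bounded_mul a f : continuous a -> continuous f -> exists C,
  forall x y, `|a x * f y| <= C.
Proof.
move=> /(compact_continuous_bounded G_compact)[A aA].
move=> /(compact_continuous_bounded G_compact)[B fB].
by exists (A * B) => x y; rewrite normrM ler_pM.
Qed.

(** The Markov property tested against functions of [X u]: [X v] is [X u] times an independent
    increment of law [mu_(v - u)]. *)
Lemma expectation_conv_op a f u v : 0 <= u -> u < v -> continuous a -> continuous f ->
  \int[P]_w (a (X u w : G) * f (X v w : G)) =
  \int[P]_w (a (X u w : G) * conv_op (increment_law (v - u)) f (X u w : G)).
Proof.
move=> u0 uv ca cf; have [C aC] := continuous_bounded_mul ca cf.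
pose F (z : G * G) : R := a z.1 * f (z.1 * z.2)%g.
have cF : continuous F.
  move=> z; apply: cvgM.
    exact: (@cvg_comp _ _ _ fst a _ _ _ cvg_fst (ca _)).
  exact: (@cvg_comp _ _ _ (fun z : G * G => (z.1 * z.2)%g) f _ _ _
    (@mulg_continuous G z) (cf _)).
have := @independent_Rintegral (X u) (increment_mfun u v) (increment_law (v - u)) F C
  (fun A B => @levy_independent_increment u v A B u0 uv) cF (fun z => aC _ _).
rewrite /F /=.
under eq_Rintegral do rewrite mulX_increment.
move=> ->; apply: eq_Rintegral => w _; rewrite /conv_op RintegralZl//.
apply: continuous_integrable => //; exact: continuous_shiftl.
Qed.

Lemma conv_op_increment_law t x f : continuous f ->
  conv_op (increment_law t) f x = \int[P]_w f (x * (increment X 0 t w : G))%g.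
Proof.
move=> cf; have cf' := @continuous_shiftl _ _ x f cf.
have mi := measurable_increment 0 t.
have mEf : measurable_fun setT (EFin \o (fun y : borel G => f (x * (y : G))%g)).
  by apply/measurable_EFinP; exact: continuous_measurable_borel cf'.
have [C fC] := compact_continuous_bounded G_compact cf'.
have fi : P.-integrable (increment X 0 t @^-1` setT)
    ((EFin \o (fun y : borel G => f (x * (y : G))%g)) \o increment X 0 t).
  rewrite preimage_setT; apply: (le_integrable_cst (C := C)) => //.
    exact: probability_lty.
  exact: measurableT_comp (continuous_measurable_borel cf') mi.
have := integral_pushforward mi mEf fi measurableT.
by rewrite /conv_op /Rintegral preimage_setT => <-.
Qed.

Lemma conv_op_increment_law0 x f : continuous f ->
  conv_op (increment_law 0) f x = f x.
Proof.
move=> cf; rewrite conv_op_increment_law//.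
under eq_Rintegral do rewrite /increment mulVg mulg1.
exact: Rintegral_probability_cst.
Qed.

(** The increment over [[0, a + b]] is the product of those over [[0, a]] and [[a, a + b]], which
    are independent. *)
Lemma conv_op_semigroup f (a b : R) x : 0 < a -> 0 < b -> continuous f ->
  conv_op (increment_law a) (conv_op (increment_law b) f) x =
  conv_op (increment_law (a + b)) f x.
Proof.
move=> a0 b0 cf; have [C fC] := compact_continuous_bounded G_compact cf.
pose F (z : G * G) : R := f (x * (z.1 * z.2))%g.
have cF : continuous F.
  move=> z; exact: (@cvg_comp _ _ _ (fun z : G * G => (z.1 * z.2)%g) _ _ _ _
    (@mulg_continuous G z) (@continuous_shiftl _ _ x f cf _)).
rewrite (conv_op_increment_law (a + b) x cf).
rewrite (conv_op_increment_law a x (@conv_op_continuous _ _ G_compact _ f cf)).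
have := @independent_Rintegral (increment_mfun 0 a) (increment_mfun a (a + b))
  (increment_law b) F C
  (fun A B => @levy_independent_increments a b A B a0 b0) cF (fun z => fC _).
rewrite /F /= => H; rewrite [RHS](_ : _ = \int[P]_w f (x * ((increment X 0 a w : G) *
  (increment X a (a + b) w : G)))%g); last first.
  by apply: eq_Rintegral => w _; rewrite /increment -mulgA mulVKg.
rewrite H; apply: eq_Rintegral => w _; rewrite /conv_op; apply: eq_Rintegral => y _.
by rewrite -mulgA.
Qed.

(** By the semigroup law both sides are the expectation of [a (X u)] times [P_(t + h - u) f (X u)],
    so independence of [X u] and one increment suffices. The case [u = t] is apart because
    increments need strictly ordered times. *)
Lemma expectation_orth a f u t h : 0 <= u -> u <= t -> 0 < h ->
  continuous a -> continuous f ->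
  \int[P]_w (a (X u w : G) * f (X (t + h) w : G)) =
  \int[P]_w (a (X u w : G) * conv_op (increment_law h) f (X t w : G)).
Proof.
move=> u0; rewrite le_eqVlt => /predU1P[<-|ut] h0 ca cf.
  by rewrite expectation_conv_op ?ltrDl// addrAC subrr add0r.
have cPf := @conv_op_continuous _ _ G_compact (increment_law h) f cf.
rewrite expectation_conv_op//; last by lra.
rewrite [RHS]expectation_conv_op//.
apply: eq_Rintegral => w _; rewrite conv_op_semigroup ?subr_gt0//.
by rewrite addrAC.
Qed.

End levy.

(** * Joint measurability of right-continuous processes *)

Section right_continuous_process.
Context {R : realType}.

Lemma measurable_fun_nat_family {d : measure_display} {T : measurableType d}
    (k : T -> nat) (g : nat -> T -> R) :
  (forall n, measurable (k @^-1` [set n])) -> (forall n, measurable_fun setT (g n)) ->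
  measurable_fun setT (fun z => g (k z) z).
Proof.
move=> mk mg _ A mA; rewrite setTI.
rewrite [X in measurable X](_ : _ =
    \bigcup_n (k @^-1` [set n] `&` (setT `&` g n @^-1` A))).
  by apply: bigcupT_measurable => n; apply: measurableI => //; exact: mg.
apply/seteqP; split => [z /= Az|z [n _ [/= <- [_ //]]]].
by exists (k z).
Qed.

(** [grid_point n (grid n t)] is the least multiple of [n.+1^-1] greater than [t];
    approaching [t] from the right makes right continuity applicable. *)
Definition grid (n : nat) (t : R) : nat := Num.truncn (n.+1%:R * t).
Definition grid_point (n k : nat) : R := k.+1%:R / n.+1%:R.

(** [grid n] is monotone, so its fibres are intervals. *)
Lemma measurable_grid n k : measurable (grid n @^-1` [set k]).
Proof.
apply: is_interval_measurable => x y /= gx gy z /andP[xz zy].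
have n0 : (0 : R) <= n.+1%:R by [].
apply/eqP; rewrite eqn_leq -{1}gy -gx /grid.
by apply/andP; split; apply: le_truncn; rewrite ler_wpM2l.
Qed.

Lemma grid_point_gt n t : 0 <= t -> t < grid_point n (grid n t).
Proof.
move=> t0; rewrite /grid_point ltr_pdivlMr ?ltr0n// mulrC.
by have /andP[_] := @truncn_itv _ (n.+1%:R * t) (mulr_ge0 (ler0n _ _) t0).
Qed.

Lemma grid_point_cvg t : 0 <= t -> grid_point n (grid n t) @[n --> \oo] --> t.
Proof.
move=> t0; apply/cvgrPdist_le => e e0.
have /cvgrPdist_le/(_ e e0) := @cvg_harmonic R.
apply: filterS => n; rewrite sub0r normrN ger0_norm ?invr_ge0// => ne.
rewrite distrC ger0_norm; last by rewrite subr_ge0 ltW// grid_point_gt.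
apply: le_trans ne; rewrite lerBlDr /grid_point /harmonic -natr1 mulrDl mul1r addrC lerD2l.
rewrite ler_pdivrMr ?ltr0n// mulrC.
by have /andP[] := @truncn_itv _ (n.+1%:R * t) (mulr_ge0 (ler0n _ _) t0).
Qed.

Context {d : measure_display} {Omega : measurableType d}.
Variables (Y : R -> Omega -> R) (N : set Omega).
Hypotheses (mY : forall t, measurable_fun setT (Y t)) (mN : measurable N).
Hypothesis Y_rc : forall w, ~ N w -> forall t, 0 <= t -> Y s w @[s --> t^'+] --> Y t w.

Definition good_domain : set (R * Omega) := `[0, +oo[%classic `*` ~` N.

(** On the good domain [Y] is the pointwise limit of its values at the grid points; each
    approximation uses countably many times only and is therefore measurable. *)
Lemma measurable_right_continuous :
  measurable_fun setT ((fun z : R * Omega => Y z.1 z.2) \_ good_domain).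
Proof.
have mG : measurable good_domain by apply: measurableX => //; exact: measurableC.
apply/(measurable_restrictT _ mG).
apply: (@measurable_fun_cvg _ _ _ _
  (fun n z => Y (grid_point n (grid n z.1)) z.2)).
- move=> n; apply: measurable_funTS.
  apply: (@measurable_fun_nat_family _ _ (fun z : R * Omega => grid n z.1)
    (fun k z => Y (grid_point n k) z.2)) => k.
  + rewrite -[X in measurable X]setTI.
    exact: (@measurable_fst _ _ R Omega measurableT _ (measurable_grid n k)).
  + exact: measurableT_comp (mY _) measurable_snd.
- move=> [t w] [/= + Nw]; rewrite in_itv/= andbT => t0.
  have /cvg_at_rightP := Y_rc Nw t0; apply.
  by split; [move=> n; exact: grid_point_gt|exact: grid_point_cvg].
Qed.

End right_continuous_process.

(** * Time shifts of integrals *)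

Section shift.
Context {R : realType}.
Local Notation leb := (@lebesgue_measure R).

Lemma lebesgue_measure_shift (h : R) (A : set R) : measurable A ->
  pushforward leb (fun t : measurableTypeR R => t + h : measurableTypeR R) A = leb A.
Proof.
move=> mA; apply/esym.
have mh : measurable_fun setT (fun t : measurableTypeR R => t + h : measurableTypeR R).
  by apply: measurable_funD; [exact: measurable_id|exact: measurable_cst].
pose hm : {mfun measurableTypeR R >-> measurableTypeR R} :=
  HB.pack (fun t : measurableTypeR R => t + h : measurableTypeR R)
    (isMeasurableFun.Build _ _ _ _ _ mh).
apply: (@lebesgue_measure_unique R (pushforward leb hm)) => //= _ [[a b]] _ <-.
rewrite /pushforward /= (_ : _ @^-1` _ = `]a - h, b - h]%classic).
  by rewrite !lebesgue_measure_itv/= !lte_fin ltrD2r -!EFinB opprB addrA subrK.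
by apply/seteqP; split => t /=; rewrite !in_itv/= ltrBlDr lerBrDr.
Qed.

(** Moving the window [[0, T]] by [h] affects only the end pieces [[0, h]] and []T, T + h]], each
    worth at most [C * h]. *)
Lemma Rintegral_shift (g : R -> R) (C h T : R) : 0 <= h -> 0 <= T ->
  measurable_fun setT g -> (forall t, `|g t| <= C) ->
  `|\int[leb]_(t in `[0, T]) g t - \int[leb]_(t in `[0, T]) g (t + h)| <= 2 * C * h.
Proof.
move=> h0 T0 mg gC.
have gi (x y : bool) (a b : R) :
    leb.-integrable [set` Interval (BSide x a) (BSide y b)] (EFin \o g).
  apply: (le_integrable_cst (C := C)) => //; first exact: lebesgue_measure_itv_lty.
  exact: measurable_funTS.
have mh : measurable_fun setT (fun t : measurableTypeR R => t + h : measurableTypeR R).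
  by apply: measurable_funD; [exact: measurable_id|exact: measurable_cst].
have preE : (fun t : measurableTypeR R => t + h : measurableTypeR R) @^-1` `[h, T + h]
    = `[0, T]%classic.
  by apply/seteqP; split => t /=; rewrite !in_itv/= lerD2r -lerBlDr subrr.
have shiftE : \int[leb]_(t in `[0, T]) g (t + h) = \int[leb]_(t in `[h, T + h]) g t.
  have mEg : measurable_fun setT (EFin \o (g : measurableTypeR R -> R)).
    exact/measurable_EFinP.
  have gi' : leb.-integrable ((fun t : measurableTypeR R => t + h : measurableTypeR R)
      @^-1` `[h, T + h]) ((EFin \o g) \o (fun t => t + h)).
    rewrite preE; apply: (le_integrable_cst (C := C)) => //.
      exact: lebesgue_measure_itv_lty.
    by apply: measurable_funTS; exact: measurableT_comp mg mh.
  have := integral_pushforward mh mEg gi' (measurable_itv _).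
  rewrite preE /Rintegral => <-; congr fine.
  by apply: eq_measure_integral => A mA _; exact: lebesgue_measure_shift.
rewrite shiftE.
have e1 := @Rintegral_itvB R g (BLeft 0) (BRight (T + h)) T (gi _ _ _ _).
have e2 := @Rintegral_itvB R g (BLeft 0) (BRight (T + h)) h (gi _ _ _ _).
have {}e1 := e1 _ _; rewrite !bnd_simp lerDl in e1; have {}e1 := e1 T0 h0.
have {}e2 := e2 _ _; rewrite !bnd_simp lerDr in e2; have {}e2 := e2 h0 T0.
have e3 := @Rintegral_itv_obnd_cbnd R h (BRight (T + h)) g (gi _ _ _ _).
have b1 : `|\int[leb]_(t in `]T, T + h]) g t| <= C * h.
  rewrite [X in _ <= C * X](_ : h = fine (leb `]T, T + h])).
    apply: le_normr_Rintegral_cst => //; first exact: lebesgue_measure_itv_lty.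
    exact: measurable_funTS.
  rewrite lebesgue_measure_itv/= lte_fin ltrDl.
  move: h0; rewrite le_eqVlt => /predU1P[<-|->]; first by rewrite ltxx.
  by rewrite /= addrAC subrr add0r.
have b2 : `|\int[leb]_(t in `[0, h]) g t| <= C * h.
  rewrite -[X in _ <= C * X](subr0 h) -fine_lebesgue_measure_itv//.
  apply: le_normr_Rintegral_cst => //; first exact: lebesgue_measure_itv_lty.
  exact: measurable_funTS.
rewrite (_ : _ - _ = \int[leb]_(t in `[0, h]) g t - \int[leb]_(t in `]T, T + h]) g t).
  rewrite (le_trans (ler_normB _ _))// (le_trans (lerD b2 b1))//.
  by rewrite -mulrA (mulr_natl _ 2) mulr2n.
by rewrite -e3 -e1 -e2; ring.
Qed.

End shift.

(** * Path averages of [f] and of [P_h f] *)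

Section levy_averages.
Context {R : realType} {G : topologicalGroupType}.
Hypotheses (G_compact : compact [set: G]) (G_metrizable : metrizable R G).
Context {d : measure_display} {Omega : measurableType d} {P : probability Omega R}.
Context {X : R -> {RV P >-> borel G}} (X_levy : is_levy X).
Local Notation leb := (@lebesgue_measure R).

Variable N : set Omega.
Hypotheses (mN : measurable N) (N0 : P N = 0).
Hypothesis X_rc : forall w, ~ N w -> forall t, 0 <= t ->
  (X s w : G) @[s --> t^'+] --> (X t w : G).

Implicit Types (f g : G -> R).

(** Set to [0] at negative times and off the event of right continuity, which
    makes it jointly measurable. *)
Definition path_fun f : R * Omega -> R :=
  (fun z => f (X z.1 z.2 : G)) \_ (good_domain N).

Lemma path_funE f t w : ~ N w -> 0 <= t -> path_fun f (t, w) = f (X t w : G).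
Proof.
move=> Nw t0; rewrite /path_fun patchE ifT//.
by rewrite inE; split => //=; rewrite in_itv/= t0.
Qed.

Lemma measurable_path_fun f : continuous f -> measurable_fun setT (path_fun f).
Proof.
move=> cf; apply: (@measurable_right_continuous _ _ _ (fun t w => f (X t w : G))) => //.
  move=> t; apply: (measurableT_comp (continuous_measurable_borel cf)).
  exact: measurable_funPT.
move=> w Nw t t0.
exact: (@cvg_comp _ _ _ (fun s => X s w : G) f _ _ _ (X_rc Nw t0) (cf _)).
Qed.

Lemma path_fun_le f C : (forall x, `|f x| <= C) -> forall z, `|path_fun f z| <= C.
Proof.
move=> fC z; rewrite /path_fun patchE; case: ifP => // _.
by rewrite normr0 (le_trans _ (fC point)).
Qed.

Lemma path_measurable f w : continuous f -> ~ N w ->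
  measurable_fun (`[0, +oo[ : set R) (fun t : R => f (X t w : G)).
Proof.
move=> cf Nw; apply: (@eq_measurable_fun _ _ _ _ _ (fun t => path_fun f (t, w))).
  by move=> t; rewrite inE/= in_itv/= andbT => t0; rewrite path_funE.
apply: measurable_funTS; apply: measurableT_comp (measurable_path_fun cf) _.
exact: pair2_measurable.
Qed.

Lemma path_integrable f w T : continuous f -> ~ N w ->
  leb.-integrable `[0, T] (EFin \o (fun t : R => f (X t w : G))).
Proof.
move=> cf Nw; have [C fC] := compact_continuous_bounded G_compact cf.
apply: (le_integrable_cst (C := C)) => //; first exact: lebesgue_measure_itv_lty.
apply: measurable_funS (path_measurable cf Nw) => //.
by move=> t /=; rewrite !in_itv/= andbT => /andP[].
Qed.

Definition path_avg w f T := T^-1 * \int[leb]_(t in `[0, T]) f (X t w : G).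

Lemma path_avgB w f g T : continuous f -> continuous g -> ~ N w ->
  path_avg w (fun x => f x - g x) T = path_avg w f T - path_avg w g T.
Proof.
move=> cf cg Nw; rewrite /path_avg RintegralB ?mulrBr//; exact: path_integrable.
Qed.

Lemma path_avgZ w f c T : continuous f -> ~ N w ->
  path_avg w (fun x => f x * c) T = path_avg w f T * c.
Proof.
move=> cf Nw; rewrite /path_avg RintegralZr ?mulrA//; exact: path_integrable.
Qed.

Lemma path_avg_sum w (I : Type) (s : seq I) (F : I -> G -> R) T :
  (forall i, continuous (F i)) -> ~ N w ->
  path_avg w (fun x => \sum_(i <- s) F i x) T = \sum_(i <- s) path_avg w (F i) T.
Proof.
move=> cF Nw; elim: s => [|i s ih].
  rewrite big_nil /path_avg; under eq_Rintegral do rewrite big_nil.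
  by rewrite Rintegral_cst// mul0r mulr0.
rewrite big_cons -ih /path_avg; under eq_Rintegral do rewrite big_cons.
rewrite RintegralD ?mulrDr//; first exact: path_integrable.
apply: (@path_integrable (fun x => \sum_(j <- s) F j x)) => //.
elim: s {ih} => [|j s ih]; first by under eq_fun do rewrite big_nil; exact: cst_continuous.
by under eq_fun do rewrite big_cons; move=> x; apply: cvgD; [exact: cF|exact: ih].
Qed.

Lemma path_avg_le w f e T : continuous f -> ~ N w -> 0 < T ->
  (forall x, `|f x| <= e) -> `|path_avg w f T| <= e.
Proof.
move=> cf Nw T0 fe; rewrite /path_avg normrM normfV (gtr0_norm T0) ler_pdivrMl//.
rewrite mulrC -[X in _ <= _ * X](subr0 T) -fine_lebesgue_measure_itv ?(ltW T0)//.
apply: le_normr_Rintegral_cst => //; first exact: lebesgue_measure_itv_lty.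
apply: measurable_funS (path_measurable cf Nw) => //.
by move=> t /=; rewrite !in_itv/= andbT => /andP[].
Qed.

Lemma path_avg_cst w c T : 0 < T -> path_avg w (fun=> c) T = c.
Proof.
move=> T0; rewrite /path_avg Rintegral_cst// fine_lebesgue_measure_itv ?(ltW T0)//.
by rewrite subr0 mulrC mulfK// gt_eqF.
Qed.

Lemma negligible_setC_ae (Q : Omega -> Prop) : (forall w, ~ N w -> Q w) ->
  {ae P, forall w, Q w}.
Proof.
move=> NQ; exists N; split => // w /= nQ; apply: contrapT => Nw; exact/nQ/NQ.
Qed.

Local Notation mu := (increment_law G_compact G_metrizable (X := X)).

(** The earlier times [s] and [s + h] are both at most [t], so replacing [f (X (t + h))] by
    [g (X t)] next to either of them keeps the expectation; the four products cancel in pairs. *)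
Lemma path_fun_orth f h s t : continuous f -> 0 < h -> 0 <= s -> s + h <= t ->
  let g := conv_op (mu h) f in
  \int[P]_w ((path_fun f (s + h, w) - path_fun g (s, w)) *
             (path_fun f (t + h, w) - path_fun g (t, w))) = 0.
Proof.
move=> cf h0 s0 st g.
have cg : continuous g by exact: conv_op_continuous.
have mpf (k : G -> R) u : continuous k -> measurable_fun setT (fun w => path_fun k (u, w)).
  by move=> ck; apply: measurableT_comp (measurable_path_fun ck) _; exact: pair1_measurable.
have mXf (k : G -> R) u : continuous k -> measurable_fun setT (fun w => k (X u w : G)).
  move=> ck; apply: (measurableT_comp (continuous_measurable_borel ck)).
  exact: measurable_funPT.
have iXX (k l : G -> R) u v : continuous k -> continuous l ->
    P.-integrable setT (EFin \o (fun w => k (X u w : G) * l (X v w : G))).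
  move=> ck cl; have [C klC] := continuous_bounded_mul G_compact ck cl.
  apply: (le_integrable_cst (C := C)) => //; first exact: probability_lty.
  by apply: measurable_funM; exact: mXf.
transitivity (\int[P]_w ((f (X (s + h) w : G) * f (X (t + h) w : G) -
    f (X (s + h) w : G) * g (X t w : G)) -
    (g (X s w : G) * f (X (t + h) w : G) - g (X s w : G) * g (X t w : G)))).
  rewrite /Rintegral; congr fine; apply: ae_eq_integral => //.
  - apply/measurable_EFinP; apply: measurable_funM; apply: measurable_funB;
    exact: mpf.
  - apply/measurable_EFinP; apply: measurable_funB; apply: measurable_funB;
    apply: measurable_funM; exact: mXf.
  - apply: negligible_setC_ae => w Nw _.
    by rewrite !path_funE//; [congr (_%:E); ring|lra..].
have iB (k l k' l' : G -> R) u v u' v' : continuous k -> continuous l -> continuous k' ->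
    continuous l' -> P.-integrable setT (EFin \o (fun w =>
      k (X u w : G) * l (X v w : G) - k' (X u' w : G) * l' (X v' w : G))).
  by move=> ck cl ck' cl'; exact: (integrableB measurableT (iXX k l u v ck cl) (iXX k' l' u' v' ck' cl')).
rewrite RintegralB//; [|exact: iB..].
rewrite !RintegralB//; [|exact: iXX..].
by rewrite !(expectation_orth G_compact G_metrizable X_levy)// ?subrr//; lra.
Qed.

(** Orthogonality concerns [f (X (t + h))] minus [P_h f (X t)]; trading [X (t + h)] for [X t] is a
    time shift and changes the averages by [O(1/T)]. *)
Lemma ae_avg_conv_op f h : continuous f -> 0 <= h ->
  {ae P, forall w, path_avg w (fun x => f x - conv_op (mu h) f x) T
    @[T --> +oo] --> (0 : R)}.
Proof.
(* At [h = 0] the law is the point mass at the identity and the operator changes nothing. *)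
move=> cf; rewrite le_eqVlt => /predU1P[<-|h0].
  apply: aeW => w.
  rewrite (_ : (fun x => f x - conv_op (mu 0) f x) = cst 0); last first.
    by apply/funext => x; rewrite /= conv_op_increment_law0// subrr.
  rewrite (_ : path_avg w _ = cst 0); first exact: cvg_cst.
  by apply/funext => T; rewrite /path_avg Rintegral_cst// mul0r mulr0.
pose g := conv_op (mu h) f.
have cg : continuous g by exact: conv_op_continuous.
have [A fA] := compact_continuous_bounded G_compact cf.
have [B gB] := compact_continuous_bounded G_compact cg.
pose D (z : R * Omega) := path_fun f (z.1 + h, z.2) - path_fun g z.
have mD : measurable_fun setT D.
  apply: measurable_funB; last exact: measurable_path_fun.
  apply: measurableT_comp (measurable_path_fun cf) _.
  apply: measurable_fun_pair; last exact: measurable_snd.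
  by apply: measurable_funD; [exact: measurable_fst|exact: measurable_cst].
have DC z : `|D z| <= A + B.
  by rewrite (le_trans (ler_normB _ _))// lerD//; exact: path_fun_le.
have := @ae_average_cvg0 _ _ _ P D (A + B) h mD DC (ltW h0)
  (fun s t s0 st => path_fun_orth cf h0 s0 st).
have NC : {ae P, forall w, ~ N w} by exact: negligible_setC_ae.
move: NC; apply: filterS2 => w Nw avgD.
pose k t := path_fun f (t, w).
have mk : measurable_fun setT k.
  by apply: measurableT_comp (measurable_path_fun cf) _; exact: pair2_measurable.
have kA t : `|k t| <= A by exact: path_fun_le.
have ik T (k' : R -> R) B' : measurable_fun setT k' -> (forall t, `|k' t| <= B') ->
    leb.-integrable `[0, T] (EFin \o k').
  move=> mk' kB'; apply: (le_integrable_cst (C := B')) => //.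
    exact: lebesgue_measure_itv_lty.
  exact: measurable_funTS.
have mkh : measurable_fun setT (fun t : R => k (t + h)).
  apply: measurableT_comp mk _.
  by apply: measurable_funD; [exact: measurable_id|exact: measurable_cst].
have mDw : measurable_fun setT (fun t => D (t, w)).
  by apply: measurableT_comp mD _; exact: pair2_measurable.
have decomp T : 0 <= T -> path_avg w (fun x => f x - g x) T =
    T^-1 * \int[leb]_(t in `[0, T]) D (t, w) +
    T^-1 * (\int[leb]_(t in `[0, T]) k t - \int[leb]_(t in `[0, T]) k (t + h)).
  move=> T0; rewrite -RintegralB//; [|exact: ik mk kA|exact: ik mkh (fun t => kA _)].
  rewrite -mulrDr -RintegralD//; last 2 first.
  - exact: ik mDw (fun t => DC _).
  - apply: (ik _ _ (A + A)); first exact: measurable_funB.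
    by move=> t; rewrite (le_trans (ler_normB _ _))// lerD.
  rewrite /path_avg; congr (_ * _); apply: eq_Rintegral => t.
  rewrite inE/= in_itv/= => /andP[t0 _]; rewrite /D /k /=.
  by rewrite !path_funE//; [ring|lra..].
apply/cvgrPdist_le => e e0.
have e2 : 0 < e / 2 by rewrite divr_gt0.
move/cvgrPdist_le : avgD => /(_ _ e2) avgD.
near=> T.
have T0 : 0 < T by near: T; exact: nbhs_pinfty_gt.
rewrite (decomp T (ltW T0)) sub0r normrN (le_trans (ler_normD _ _))//.
rewrite [leRHS](splitr e) lerD//.
  by rewrite -normrN -sub0r; near: T.
rewrite normrM normfV (gtr0_norm T0) ler_pdivrMl//.
rewrite (le_trans (Rintegral_shift (ltW h0) (ltW T0) mk kA))//.
rewrite -ler_pdivrMr//; near: T; exact: nbhs_pinfty_ge.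
Unshelve. all: by end_near.
Qed.

End levy_averages.

(** * Uniform approximation by a countable family *)

Section partition_of_unity.
Context {R : realType} {G : topologicalGroupType}.
Hypotheses (G_compact : compact [set: G]) (G_metrizable : metrizable R G).

(** The normalized tents [p k i] form a partition of unity for every [k]. *)
Lemma countable_dense_span : exists (N : nat -> nat) (p : nat -> nat -> G -> R),
  (forall k i, continuous (p k i)) /\
  forall f, continuous f -> forall e, 0 < e -> exists k (c : nat -> R), forall x,
    `|f x - \sum_(i < N k) p k i x * c i| <= e.
Proof.
have [N [psi [cpsi cover _ osc]]] := metrizable_compact_base G_compact G_metrizable.
pose b k i x := Num.max 0 (psi k i x).
pose S k x := \sum_(i < N k) b k i x.
have b0 k i x : 0 <= b k i x by rewrite /b le_max lexx.
have S0 k x : 0 < S k x.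
  have [i iN ix] := cover k x; rewrite /S (bigD1 (Ordinal iN))//=.
  by rewrite ltr_pwDl ?sumr_ge0// /b lt_max ix orbT.
have cb k i : continuous (b k i).
  by move=> x; apply: continuous_max; [exact: cst_continuous|exact: cpsi].
have cS k : continuous (S k).
  rewrite /S; elim: (index_enum _) => [|i s ih].
    by under eq_fun do rewrite big_nil; exact: cst_continuous.
  by under eq_fun do rewrite big_cons; move=> x; apply: cvgD; [exact: cb|exact: ih].
exists N, (fun k i x => b k i x / S k x); split=> [k i x|f cf e e0].
  by apply: cvgM; [exact: cb|apply: cvgV; [rewrite gt_eqF|exact: cS]].
have [k hk] := osc f cf e e0.
(* The coefficient is the value of [f] at a sample point of the ball; for an empty ball [get]
   returns a default, but the corresponding weight vanishes everywhere. *)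
exists k, (fun i => f (get [set y | 0 < psi k i y])) => x.
have -> : f x = \sum_(i < N k) b k i x / S k x * f x.
  by rewrite -!mulr_suml -/(S k x) divff ?mul1r// gt_eqF.
rewrite -sumrB (le_trans (ler_norm_sum _ _ _))//.
have -> : e = \sum_(i < N k) b k i x / S k x * e.
  by rewrite -!mulr_suml -/(S k x) divff ?mul1r// gt_eqF.
apply: ler_sum => i _; rewrite -mulrBr normrM ger0_norm; last by rewrite divr_ge0// ltW.
have [ix|ix] := ltP 0 (psi k i x); last by rewrite /b max_l// !mul0r.
apply: ler_wpM2l; first by rewrite divr_ge0// ltW.
apply: (hk i) => //; exact: (@getI _ [set y | 0 < psi k i y] x ix).
Qed.

End partition_of_unity.

(** * Almost sure convergence of averages to the Haar integral *)

Section levy_equidistribution.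
Context {R : realType} {G : topologicalGroupType}.
Hypotheses (G_compact : compact [set: G]) (G_metrizable : metrizable R G).
Variable lambda : probability (borel G) R.
Hypothesis lambda_haar : is_haar lambda.
Context {d : measure_display} {Omega : measurableType d} {P : probability Omega R}.
Context {X : R -> {RV P >-> borel G}} (X_levy : is_levy X).

Variable N : set Omega.
Hypotheses (mN : measurable N) (N0 : P N = 0).
Hypothesis X_rc : forall w, ~ N w -> forall t, 0 <= t ->
  (X s w : G) @[s --> t^'+] --> (X t w : G).

Local Notation mu := (increment_law G_compact G_metrizable (X := X)).
Local Notation haar f := (\int[lambda]_(x in [set: borel G]) f x).
Local Notation avg := (@path_avg R G d Omega P X).

Lemma ae_setC : {ae P, forall w, ~ N w}.
Proof. exact: (negligible_setC_ae mN N0). Qed.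

Lemma ae_avg_mean_op (f : G -> R) (s : seq R) : continuous f -> (0 < size s)%N ->
  (forall t, t \in s -> 0 <= t) ->
  {ae P, forall w, avg w (fun x => f x - mean_op mu s f x) T @[T --> +oo] --> (0 : R)}.
Proof.
move=> cf s0 hs.
(* Past the end of [s] the default time [0] is again admissible, so all natural indices may be used
   in a countable intersection. *)
have all_ae : {ae P, forall w, forall i,
    avg w (fun x => f x - conv_op (mu (nth 0 s i)) f x) T @[T --> +oo] --> (0 : R)}.
  apply: ae_foralln => i.
  apply: (ae_avg_conv_op G_compact G_metrizable X_levy mN N0 X_rc cf).
  have [si|si] := ltnP i (size s); last by rewrite nth_default.
  by apply: hs; exact: mem_nth.
move: ae_setC all_ae; apply: filterS2 => w Nw hw.
pose F (t : R) (x : G) := f x - conv_op (mu t) f x.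
have cF t : continuous (F t).
  by move=> x; apply: cvgB; [exact: cf|exact: conv_op_continuous].
have meanE : (fun x => f x - mean_op mu s f x) =
    (fun x => (\sum_(t <- s) F t x) * (size s)%:R^-1).
  apply/funext => x; rewrite /mean_op /F sumrB -mulr_size_sum mulrBl mulfK//.
  by rewrite pnatr_eq0 -lt0n.
have csum : continuous (fun x => \sum_(t <- s) F t x).
  elim: (s) => [|t r ih].
    by under eq_fun do rewrite big_nil; exact: cst_continuous.
  by under eq_fun do rewrite big_cons; move=> x; apply: cvgD; [exact: cF|exact: ih].
have avgE T : avg w (fun x => f x - mean_op mu s f x) T =
    (\sum_(t <- s) avg w (F t) T) * (size s)%:R^-1.
  rewrite meanE (path_avgZ G_compact mN X_rc)//.
  by rewrite (path_avg_sum G_compact mN X_rc).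
rewrite (_ : avg w _ = fun T => (\sum_(t <- s) avg w (F t) T) * (size s)%:R^-1);
  last exact/funext.
rewrite -[X in _ --> X](mul0r (size s)%:R^-1); apply: cvgM; last exact: cvg_cst.
have : forall t, t \in s -> avg w (F t) T @[T --> +oo] --> (0 : R).
  by move=> t ts; have := hw (index t s); rewrite nth_index.
elim: (s) => [|t r ih] hr.
  by under eq_fun do rewrite big_nil; exact: cvg_cst.
have h1 := hr t (mem_head _ _).
have h2 := ih (fun u ur => hr u (mem_behead (s := t :: r) ur)).
rewrite (_ : (fun T => _) = fun T => avg w (F t) T + \sum_(u <- r) avg w (F u) T).
  by rewrite -[X in _ --> X](addr0 0); apply: cvgD.
by apply/funext => T; rewrite big_cons.
Qed.

Hypothesis mu_dense : forall U : set G, open U -> U !=set0 ->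
  exists2 t, 0 <= t & (0 < mu t U)%E.

(** The iterate [g] of the mean operator depends on [e], and so does the null set; this is why [e]
    is fixed outside the almost sure statement. Each iteration adds one null set, and finitely many
    occur. *)
Lemma ae_avg_near_haar (f : G -> R) (e : R) : continuous f -> 0 < e ->
  {ae P, forall w, \forall T \near +oo, `|haar f - avg w f T| <= e}.
Proof.
move=> cf e0.
pose Q (g : G -> R) := haar g = haar f /\
  {ae P, forall w, avg w (fun x => f x - g x) T @[T --> +oo] --> (0 : R)}.
(* Three errors of this size occur: the Haar integral of [g] against [c], the averages of [f]
   against those of [g], and the averages of [g] against [c]. *)
have e4 : 0 < e / 4 by rewrite divr_gt0.
have [|g s cg s0 hs [gf avgfg]|g [c [cg [gf avgfg] gc]]] :=
    mean_op_near_cst G_compact mu_dense (Q := Q) cf _ _ e4.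
- split=> //; apply: aeW => w.
  rewrite (_ : avg w _ = cst 0); first exact: cvg_cst.
  apply/funext => T; rewrite /path_avg; under eq_Rintegral do rewrite subrr.
  by rewrite Rintegral_cst// mul0r mulr0.
- split; first by rewrite (haar_mean_op G_compact G_metrizable lambda_haar).
  have cm : continuous (mean_op mu s g) by exact: mean_op_continuous.
  have := ae_avg_mean_op cg s0 hs.
  move: ae_setC avgfg; apply: filterS3 => w Nw h1 h2.
  rewrite (_ : avg w _ = fun T => avg w (fun x => f x - g x) T +
    avg w (fun x => g x - mean_op mu s g x) T); last first.
    by apply/funext => T; rewrite !(path_avgB G_compact mN X_rc)//; ring.
  by rewrite -[X in _ --> X](addr0 0); exact: cvgD.
have haar_gc : `|haar g - c| <= e / 4.
  rewrite -(Rintegral_probability_cst lambda c) -RintegralB//; last 2 first.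
  - exact: continuous_integrable.
  - exact: finite_measure_integrable_cst.
  rewrite -[leRHS]mulr1 -[X in _ <= _ * X](fine_probability_setT lambda).
  apply: le_normr_Rintegral_cst => //; first exact: probability_lty.
  apply: measurable_funB; last exact: measurable_cst.
  exact: continuous_measurable_borel.
move: ae_setC avgfg; apply: filterS2 => w Nw /cvgrPdist_le/(_ _ e4) hw.
near=> T.
have T0 : 0 < T by near: T; exact: nbhs_pinfty_gt.
have h1 : `|avg w (fun x => f x - g x) T| <= e / 4.
  by rewrite -normrN -sub0r; near: T.
have h2 : `|avg w (fun x => g x - c) T| <= e / 4.
  apply: (path_avg_le mN X_rc) => //.
  by move=> x; apply: cvgB; [exact: cg|exact: cst_continuous].
rewrite (path_avgB G_compact mN X_rc) in h1 => //.
rewrite (path_avgB G_compact mN X_rc) ?path_avg_cst// in h2; last exact: cst_continuous.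
rewrite -gf; move: haar_gc h1 h2; rewrite !ler_norml.
by move=> /andP[? ?] /andP[? ?] /andP[? ?]; apply/andP; split; lra.
Unshelve. all: by end_near.
Qed.

Lemma ae_avg_haar (f : G -> R) : continuous f ->
  {ae P, forall w, avg w f T @[T --> +oo] --> haar f}.
Proof.
move=> cf.
have : {ae P, forall w, forall n : nat, \forall T \near +oo, `|haar f - avg w f T| <= n.+1%:R^-1}.
  by apply: ae_foralln => n; apply: ae_avg_near_haar.
apply: filterS => w hw; apply/cvgrPdist_le => e e0.
have [n /= ne] := @ltr_add_invr R 0 e e0; rewrite add0r in ne.
by have := hw n; apply: filterS => T /le_trans; apply; exact: ltW.
Qed.

(** One null set serves all [f]: it is enough to treat the countably many [p k i], since averages
    along a fixed path are linear and arbitrary real coefficients cost nothing. *)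
Lemma ae_avg_haar_all : {ae P, forall w, forall f : G -> R, continuous f ->
  avg w f T @[T --> +oo] --> haar f}.
Proof.
have [M [p [cp pspan]]] := countable_dense_span G_compact G_metrizable.
have : {ae P, forall w, forall k i, avg w (p k i) T @[T --> +oo] --> haar (p k i)}.
  by apply: ae_foralln => k; apply: ae_foralln => i; exact: ae_avg_haar.
move: ae_setC; apply: filterS2 => w Nw hw f cf.
apply/cvgrPdist_le => e e0.
have e3 : 0 < e / 3 by rewrite divr_gt0.
have [k [c fc]] := pspan f cf _ e3.
pose F i x := p k i x * c i.
have cF i : continuous (F i) by move=> x; apply: cvgM; [exact: cp|exact: cst_continuous].
pose g x := \sum_(i < M k) F i x.
have cg : continuous g.
  rewrite /g; elim: (index_enum _) => [|i s ih].
    by under eq_fun do rewrite big_nil; exact: cst_continuous.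
  by under eq_fun do rewrite big_cons; move=> x; apply: cvgD; [exact: cF|exact: ih].
have cfg : continuous (fun x => f x - g x) by move=> x; apply: cvgB; [exact: cf|exact: cg].
have haarg : haar g = \sum_(i < M k) haar (p k i) * c i.
  rewrite /g; elim: (index_enum _) => [|i s ih].
    under eq_Rintegral do rewrite big_nil.
    by rewrite big_nil Rintegral_probability_cst.
  under eq_Rintegral do rewrite big_cons.
  rewrite big_cons -ih RintegralD//.
  - by rewrite RintegralZr//; exact: continuous_integrable.
  - exact: continuous_integrable.
  - apply: continuous_integrable => //; elim: s {ih} => [|j s ih].
      by under eq_fun do rewrite big_nil; exact: cst_continuous.
    by under eq_fun do rewrite big_cons; move=> x; apply: cvgD; [exact: cF|exact: ih].
have avgg : avg w g T @[T --> +oo] --> haar g.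
  rewrite haarg (_ : avg w g = fun T => \sum_(i < M k) avg w (p k i) T * c i); last first.
    apply/funext => T; rewrite (path_avg_sum G_compact mN X_rc)//.
    by apply: eq_bigr => i _; rewrite (path_avgZ G_compact mN X_rc).
  elim: (index_enum _) => [|i s ih].
    by under eq_fun do rewrite big_nil; rewrite big_nil; exact: cvg_cst.
  rewrite big_cons (_ : (fun T => _) =
      fun T => avg w (p k i) T * c i + \sum_(j <- s) avg w (p k j) T * c j).
    by apply: cvgD; [apply: cvgM; [exact: hw|exact: cvg_cst]|exact: ih].
  by apply/funext => T; rewrite big_cons.
have haarfg : `|haar f - haar g| <= e / 3.
  rewrite -RintegralB//; do ?exact: continuous_integrable.
  rewrite -[leRHS]mulr1 -[X in _ <= _ * X](fine_probability_setT lambda).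
  apply: le_normr_Rintegral_cst => //; first exact: probability_lty.
  exact: continuous_measurable_borel.
move/cvgrPdist_le : avgg => /(_ _ e3) avgg.
near=> T.
have T0 : 0 < T by near: T; exact: nbhs_pinfty_gt.
have h1 : `|haar g - avg w g T| <= e / 3 by near: T.
have h2 : `|avg w f T - avg w g T| <= e / 3.
  rewrite -(path_avgB G_compact mN X_rc)//.
  exact: (path_avg_le mN X_rc).
move: haarfg h1 h2; rewrite !ler_norml.
by move=> /andP[? ?] /andP[? ?] /andP[? ?]; apply/andP; split; lra.
Unshelve. all: by end_near.
Qed.

(** The countably many sets [V n] form a base, so measurability of the [G]-valued path follows from
    that of the real functions [psi k i] along it. *)
Lemma path_measurable_borel w : ~ N w ->
  measurable_fun (`[0, +oo[ : set R) (fun t => X t w : borel G).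
Proof.
move=> Nw.
have [M [psi [cpsi cover base _]]] := metrizable_compact_base G_compact G_metrizable.
apply: (measurability (@open G : set (set (borel G))) erefl).
move=> _ [U oU <-].
pose V (n : nat * nat) := [set y : G | 0 < psi n.1 n.2 y].
have UE : (U : set G) = \bigcup_(n in [set n | V n `<=` U]) V n.
  apply/seteqP; split=> [x Ux|x [n /= VU]]; last exact: VU.
  have [k hk] := base x U (open_nbhs_nbhs (conj oU Ux)).
  by have [i _ ix] := cover k x; exists (k, i) => //; exact: hk.
rewrite UE preimage_bigcup setI_bigcupr bigcup_mkcond.
apply: countable_bigcupT_measurable; first exact: countableP.
move=> n; case: ifP => // _.
rewrite (_ : _ @^-1` _ = (fun t => psi n.1 n.2 (X t w : G)) @^-1` `]0, +oo[); last first.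
  by apply/seteqP; split => t /=; rewrite in_itv/= andbT.
by apply: (path_measurable mN X_rc (cpsi n.1 n.2) Nw) => //; exact: measurable_itv.
Qed.

End levy_equidistribution.

(** * Complex limits by real and imaginary parts *)

Section complex_limits.
Context {R : realType} {T : Type} {F : set_system T} {FF : Filter F}.

Lemma cvg_Re (z : T -> R[i]^o) (z0 : R[i]^o) : z @ F --> z0 ->
  complex.Re (z t) @[t --> F] --> complex.Re z0.
Proof.
move=> /cvgrPdist_lt zz0; apply/cvgrPdist_lt => e e0.
have ec : 0 < (e%:C)%C :> R[i] by rewrite ltcR.
apply: filterS (zz0 _ ec) => t; rewrite -ltcR; apply: le_lt_trans.
by apply: le_trans (normc_ge_Re _); rewrite raddfB.
Qed.

Lemma cvg_Im (z : T -> R[i]^o) (z0 : R[i]^o) : z @ F --> z0 ->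
  complex.Im (z t) @[t --> F] --> complex.Im z0.
Proof.
move=> /cvgrPdist_lt zz0; apply/cvgrPdist_lt => e e0.
have ec : 0 < (e%:C)%C :> R[i] by rewrite ltcR.
apply: filterS (zz0 _ ec) => t; rewrite -ltcR; apply: le_lt_trans.
rewrite normc_def lecR -raddfB /= -sqrtr_sqr; apply: ler_wsqrtr.
by rewrite lerDr sqr_ge0.
Qed.

Lemma cvg_complex (a b : T -> R) (a0 b0 : R) : a @ F --> a0 -> b @ F --> b0 ->
  ((a t +i* b t)%C : R[i]^o) @[t --> F] --> ((a0 +i* b0)%C : R[i]^o).
Proof.
move=> /cvgrPdist_lt aa0 /cvgrPdist_lt bb0; apply/cvgrPdist_lt => e e0.
(* The tolerance [e] is a complex number; being positive, it is real. *)
have er : (complex.Re e)%:C%C = e by apply: RRe_real; exact: gtr0_real.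
have e2 : 0 < complex.Re e / 2 by rewrite divr_gt0// -ltcR er.
near=> t.
have ha : `|a0 - a t| < complex.Re e / 2 by near: t; exact: aa0.
have hb : `|b0 - b t| < complex.Re e / 2 by near: t; exact: bb0.
rewrite -er normc_def ltcR /=.
apply: (@le_lt_trans _ _ (`|a0 - a t| + `|b0 - b t|)); last by lra.
move: (a0 - a t) (b0 - b t) => u v.
rewrite -[leRHS]ger0_norm ?addr_ge0// -sqrtr_sqr; apply: ler_wsqrtr.
rewrite -(@real_normK _ u) ?num_real// -(@real_normK _ v) ?num_real// sqrrD.
by rewrite addrAC lerDl mulrn_wge0// mulr_ge0.
Unshelve. all: by end_near.
Qed.

End complex_limits.

(** * Open sets charged and closed sets missed by a measure *)

Section support.
Context {R : realType} {G : topologicalGroupType}.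
Hypothesis G_compact : compact [set: G].
Variable nu : probability (borel G) R.

(** Were [U] null, its complement would be closed of full measure and would contain the support. *)
Lemma measure_support_charged (U : set G) y : open U -> U y -> measure_support nu y ->
  (0 < nu U)%E.
Proof.
move=> oU Uy Sy; rewrite lt0e measure_ge0 andbT; apply/eqP => U0.
suff : (~` U) y by apply.
apply: Sy; split=> [|//]; split; first exact: open_closedC.
have := probability_setC nu (open_borel oU); rewrite U0 sube0; exact.
Qed.

(** Every point of [K] lies in a null open set, the complement of some closed set of full measure;
    by compactness finitely many of these cover [K]. *)
Lemma not_measure_support_null (K : set G) : closed K ->
  (forall y, K y -> ~ measure_support nu y) -> nu K = 0%E.
Proof.
move=> cK KS.
have full_closed y : K y -> exists F : set G, [/\ closed F, nu F = 1%E & ~ F y].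
  move=> /KS; rewrite /measure_support /smallest => nS.
  apply: contrapT => nF; apply: nS => F [[cF F1] _]; apply: contrapT => Fy.
  by apply: nF; exists F.
have /choice[F hF] : forall y, exists F : set G, K y ->
    [/\ closed F, nu F = 1%E & ~ F y].
  move=> y; have [Ky|nKy] := pselect (K y); last by exists set0.
  by have [F FP] := full_closed y Ky; exists F.
have : compact K by apply: subclosed_compact G_compact _.
rewrite compact_cover => /(_ G K (fun y => ~` F y)) [y /hF[cF _ _]|y Ky|s sK cs].
- exact: closed_openC.
- by exists y => //; have [_ _] := hF y Ky.
have : {ae nu, forall y, forall x, x \in (finmap.enum_fset s) -> F x y}.
  have : forall x, x \in (finmap.enum_fset s) -> K x.
    by move=> x xs; have := sK x xs; rewrite inE.
  elim: (finmap.enum_fset s) => [|x r ih] rK; first by apply: aeW.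
  have [cF F1 _] := hF x (rK x (mem_head _ _)).
  have mF : measurable (F x : set (borel G)).
    by rewrite -(setCK (F x)); apply: measurableC; apply: open_borel; exact: closed_openC.
  have aeF : {ae nu, forall y, F x y}.
    exists (~` F x); split => //; first exact: measurableC.
    by rewrite probability_setC// F1 subee.
  have aer := ih (fun y yr => rK y (mem_behead (s := x :: r) yr)).
  have FF : Filter (almost_everywhere nu) by exact: ae_filter_ringOfSetsType.
  apply: (@filterS2 _ _ FF _ _ _ _ aeF aer) => y Fxy hr z.
  by rewrite inE => /predU1P[->//|]; exact: hr.
move=> [B [mB B0 hB]].
have mK : measurable (K : set (borel G)).
  by rewrite -(setCK K); apply: measurableC; apply: open_borel; exact: closed_openC.
apply: (subset_measure0 mK mB _ B0).
by move=> y /cs[x xs nFxy]; apply: hB => /(_ x xs).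
Qed.

End support.

(** * The two implications of the equivalence *)

Section equidistribution_equivalence.
Context {R : realType} {G : topologicalGroupType}.
Hypotheses (G_compact : compact [set: G]) (G_metrizable : metrizable R G).
Variable lambda : probability (borel G) R.
Hypothesis lambda_haar : is_haar lambda.
Context {d : measure_display} {Omega : measurableType d} {P : probability Omega R}.
Context {X : R -> {RV P >-> borel G}} (X_levy : is_levy X).

Local Notation mu := (increment_law G_compact G_metrizable (X := X)).
Local Notation avg := (@path_avg R G d Omega P X).
Local Notation S t := (measure_support (pushforward P (increment X 0 t))).

(** A measurable null set is extracted because the event of irregular paths is only known to be
    negligible. *)
Lemma levy_right_continuous : exists N : set Omega, [/\ measurable N, P N = 0 &
  forall w, ~ N w -> forall t, 0 <= t -> (X s w : G) @[s --> t^'+] --> (X t w : G)].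
Proof.
have [N [mN N0 hN]] := levy_cadlag X_levy; exists N; split => // w Nw.
by apply: contrapT => nrc; apply: Nw; apply: hN => -[rc _]; exact: nrc.
Qed.

Lemma dense_support_ae_cud :
  dense (\bigcup_(t in [set t : R | 0 <= t]) S t) ->
  {ae P, forall w, cud lambda (fun t => X t w : G)}.
Proof.
move=> Sd; have [N [mN N0 X_rc]] := levy_right_continuous.
have mu_dense (U : set G) : open U -> U !=set0 -> exists2 t, 0 <= t & (0 < mu t U)%E.
  move=> oU U0; have [y [Uy [t t0 Sy]]] := Sd U U0 oU.
  by exists t => //; exact: (@measure_support_charged _ _ (mu t) U y).
have := ae_avg_haar_all lambda_haar X_levy mN N0 X_rc mu_dense.
move: (ae_setC mN N0); apply: filterS2 => w Nw hw; split.
  exact: (path_measurable_borel G_compact G_metrizable mN X_rc Nw).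
move=> phi cphi.
have cRe : continuous (fun x => complex.Re (phi x)) by move=> x; apply: cvg_Re; exact: cphi.
have cIm : continuous (fun x => complex.Im (phi x)) by move=> x; apply: cvg_Im; exact: cphi.
rewrite (_ : (fun T => _) = fun T => (avg w (fun x => complex.Re (phi x)) T +i*
    avg w (fun x => complex.Im (phi x)) T)%C : R[i]^o).
  by apply: cvg_complex; exact: hw.
apply/funext => T; rewrite /path_avg /Cintegral.
by apply/eqP; rewrite eq_complex /=; rewrite !mul0r subr0 addr0 !eqxx.
Qed.

(** Finitely many right translates of [f] have a sum at least [f y0 / 2]. *)
Lemma haar_integral_gt0 (f : G -> R) y0 : continuous f -> (forall x, 0 <= f x) ->
  0 < f y0 -> 0 < \int[lambda]_(x in [set: borel G]) f x.
Proof.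
move=> cf f0 fy0.
pose W : set G := [set g | f y0 / 2 < f (g * y0)%g].
have oW : open W.
  by have /continuousP/(_ _ (@open_gt R (f y0 / 2))) := @continuous_shiftr _ _ y0 f cf.
have W1 : W 1%g by rewrite /W/= mul1g; lra.
have [s hs] := translates_finite_net G_compact oW W1.
(* For every [x] some [z] of the net has [x * z^-1] in [W], which makes [h z x] exceed [f y0 / 2];
   by right invariance every [h z] has the same integral as [f]. *)
pose h (z x : G) := f (x * (z^-1 * y0))%g.
have ch z : continuous (h z) by exact: continuous_shiftr.
have csum r : continuous (fun x => \sum_(z <- r) h z x).
  elim: r => [|z r ih].
    by under eq_fun do rewrite big_nil; exact: cst_continuous.
  by under eq_fun do rewrite big_cons; move=> x; apply: cvgD; [exact: ch|exact: ih].
have sum_ge x : f y0 / 2 <= \sum_(z <- s) h z x.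
  have [z zs] := hs x; rewrite /W /= => /ltW/le_trans; apply.
  rewrite (big_rem _ zs)/= /h mulgA lerDl sumr_ge0// => i _.
have sum_int r : \int[lambda]_(x in [set: borel G]) (\sum_(z <- r) h z x) =
    (\int[lambda]_(x in [set: borel G]) f x) * (size r)%:R.
  elim: r => [|z r ih].
    under eq_Rintegral do rewrite big_nil.
    by rewrite mulr0 Rintegral_probability_cst.
  under eq_Rintegral do rewrite big_cons.
  rewrite RintegralD//; [|exact: continuous_integrable..].
  by rewrite ih (haar_mulr G_compact G_metrizable lambda_haar)//= -natr1 mulrDr mulr1 addrC.
have : f y0 / 2 <= (\int[lambda]_(x in [set: borel G]) f x) * (size s)%:R.
  rewrite -sum_int -[leLHS](Rintegral_probability_cst lambda).
  apply: le_Rintegral => //; first exact: finite_measure_integrable_cst.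
  exact: continuous_integrable.
move=> le_int; have : 0 < (\int[lambda]_(x in [set: borel G]) f x) * (size s)%:R.
  by apply: lt_le_trans le_int; rewrite divr_gt0.
have [->|i0] := eqVneq (\int[lambda]_(x in [set: borel G]) f x) 0.
  by rewrite mul0r ltxx.
by move=> _; rewrite lt_neqAle eq_sym i0 Rintegral_ge0.
Qed.

Lemma ae_cud_dense_support :
  {ae P, forall w, cud lambda (fun t => X t w : G)} ->
  dense (\bigcup_(t in [set t : R | 0 <= t]) S t).
Proof.
move=> X_cud; apply: contrapT => /denseNE[U [[y0 [oU Uy0]] US]].
have [N [mN N0 X_rc]] := levy_right_continuous.
have [M [psi [cpsi cover base _]]] := metrizable_compact_base G_compact G_metrizable.
have [k hk] := base y0 U (open_nbhs_nbhs (conj oU Uy0)).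
have [i _ iy0] := cover k y0; have {}hk := hk i iy0.
(* Half the height at [y0]: the bump [f] below is positive at [y0] and vanishes off the closed set
   [K], which lies in [U] and is therefore null for every [mu t]. *)
pose r := psi k i y0 / 2.
have r0 : 0 < r by rewrite divr_gt0.
pose K := [set y : G | r <= psi k i y].
have cK : closed K.
  exact: (preimage_closed (fun y _ => cpsi k i y) (@closed_ge R r)).
have mK : measurable (K : set (borel G)).
  by rewrite -(setCK K); apply: measurableC; apply: open_borel; exact: closed_openC.
pose f y := Num.max 0 (psi k i y - r).
have cf : continuous f.
  move=> y; apply: (@continuous_max _ _ (cst 0) (fun y => psi k i y - r)).
    exact: cst_continuous.
  by apply: cvgB; [exact: cpsi|exact: cst_continuous].
have fK y : ~ K y -> f y = 0.
  by move=> /negP; rewrite -ltNge => ?; rewrite /f max_l// subr_le0 ltW.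
have muK t : 0 <= t -> P (increment X 0 t @^-1` K) = 0%E.
  move=> t0; apply: (@not_measure_support_null _ _ G_compact (mu t)) => // y Ky Sy.
  have : (U `&` \bigcup_(t in [set t : R | 0 <= t]) S t) y.
    by split; [apply: hk; exact: lt_le_trans Ky|exists t].
  by rewrite US.
have ae0 : {ae P, forall w, forall n j, f (increment X 0 (grid_point n j) w : G) = 0}.
  apply: ae_foralln => n; apply: ae_foralln => j.
  exists (increment X 0 (grid_point n j) @^-1` K); split.
  - rewrite -[X in measurable X]setTI.
    exact: (measurable_increment G_compact G_metrizable).
  - by apply: muK; rewrite /grid_point divr_ge0.
  - by move=> w /= nf; apply: contrapT => nK; apply: nf; exact: fK.
have [w [Nw w0 [_ Xw]]] : exists w, [/\ ~ N w,
    forall n j, f (increment X 0 (grid_point n j) w : G) = 0 &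
    cud lambda (fun t => X t w : G)].
  (* A single path suffices; the complement of a null set is nonempty because the total mass is
     [1]. *)
  have [B [mB B0 hB]] := filterI (filterI (ae_setC mN N0) ae0) X_cud.
  have [BT|/existsNP[w Bw]] := pselect (forall w, B w).
    have : P setT = 0%E by rewrite -B0; congr (P _); apply/seteqP; split.
    by rewrite probability_setT => /eqP; rewrite eqe oner_eq0.
  exists w; apply: contrapT => nw; apply: Bw; apply: hB => -[[Nw w0] Xw].
  exact: nw.
pose g x := f ((X 0 w : G)^-1 * x)%g.
have cg : continuous g by exact: continuous_shiftl.
(* Grid points approach every time from the right, so right continuity extends the vanishing to all
   times. *)
have g0 t : 0 <= t -> g (X t w) = 0.
  move=> t0; have gX : (g (X s w : G)) @[s --> t^'+] --> g (X t w).
    exact: (@cvg_comp _ _ _ (fun s => X s w : G) g _ _ _ (X_rc w Nw t t0) (cg _)).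
  have gu : g (X (grid_point n (grid n t)) w : G) @[n --> \oo] --> g (X t w).
    have /cvg_at_rightP := gX; apply; split; last exact: grid_point_cvg.
    by move=> n; exact: grid_point_gt.
  have : g (X (grid_point n (grid n t)) w : G) @[n --> \oo] --> (0 : R).
    rewrite (_ : (fun n => _) = cst 0); first exact: cvg_cst.
    by apply/funext => n; exact: w0.
  exact: cvg_unique gu.
have cgC : continuous (fun x => (g x)%:C%C : R[i]^o).
  by move=> x; apply: cvg_complex; [exact: cg|exact: cvg_cst].
have /cvg_Re := Xw _ cgC.
rewrite (_ : (fun T => _) = cst 0); last first.
  apply/funext => T; rewrite /Cintegral /=.
  rewrite (@eq_Rintegral _ _ _ _ _ (cst 0)); last first.
    by move=> t; rewrite inE/= in_itv/= => /andP[t0 _]; rewrite g0.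
  by rewrite Rintegral_cst// !mul0r mulr0 subr0.
move=> lim0.
have int0 : \int[lambda]_(x in [set: borel G]) g x = 0.
  exact: (cvg_unique _ lim0 (cvg_cst (0 : R))).
have : 0 < \int[lambda]_(x in [set: borel G]) f x.
  apply: (@haar_integral_gt0 f y0) => // [x|]; first by rewrite /f le_max lexx.
  by rewrite /f lt_max subr_gt0 /r; apply/orP; right; lra.
(* Left invariance undoes the translation by the random point [X 0 w]. *)
rewrite -(haar_mull G_compact lambda_haar (X 0 w : G)^-1%g cf).
by rewrite -/(g _) int0 ltxx.
Qed.

End equidistribution_equivalence.

Theorem theorem3 (R : realType) (G : topologicalGroupType)
    (G_compact : compact [set: G]) (G_metrizable : metrizable R G)
    (lambda : probability (borel G) R) (lambda_haar : is_haar lambda)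
    (d : measure_display) (Omega : measurableType d) (P : probability Omega R)
    (X : R -> {RV P >-> borel G}) (X_levy : is_levy X) :
  dense (\bigcup_(t in [set t : R | 0 <= t])
           measure_support (pushforward P (increment X 0 t)))
  <->
  {ae P, forall w, cud lambda (fun t => X t w : G)}.
Proof.
split.
  exact (dense_support_ae_cud G_compact G_metrizable lambda_haar X_levy).
exact (ae_cud_dense_support G_compact G_metrizable lambda_haar X_levy).
Qed.
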